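(* Let $f(\cdot,t)=f_{t}$ solve the flow $\partial_{t}f=(2\sin^{2}(\pi F)-1)f$ with initial density $f_{0}$. Then $V=\tan(\pi F)$ satisfies the linear equation $\partial_{t}V=-V$ pointwise; hence $$\tan\big(\pi F(x,t)\big)=e^{-t}\tan\big(\pi F_{0}(x)\big),\qquad f(x,t)=\frac{e^{-t}f_{0}(x)}{\cos^{2}(\pi F_{0}(x))+e^{-2t}\sin^{2}(\pi F_{0}(x))}.$$ Consequently, for every $f_{0}\in\mathcal{D}_{+}$ with median $m$ and $X_{t}\sim f_{t}$, $$e^{t}(X_{t}-m)\xrightarrow{\ d\ }\mathrm{Cauchy}\Big(0,\frac{1}{\pi f_{0}(m)}\Big)\qquad(t\to\infty),$$ and, if moreover $\mathbb{E}_{f_{0}}|\log f_{0}(X)|<\infty$, the differential entropy satisfies $$H(f_{t})=-t+\log\frac{4}{f_{0}(m)}+o(1)\qquad(t\to\infty),$$ so that entropy is dissipated at unit asymptotic rate; correspondingly, for every $f_{0}\in\mathcal{D}_{+}$ with $\mathbb{E}_{f_{0}}|\log f_{0}(X)|<\infty$, $H(f_{n+1})-H(f_{n})\to-\log 2$ as $n\to\infty$ along the discrete iteration $f_{n}=\rho^{n}[f_{0}]$. The constant $\log(4/f_{0}(m))$ is the differential entropy of the limiting law $\mathrm{Cauchy}(0,1/(\pi f_{0}(m)))$.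
   Context: $\mathcal{D}_{+}$ is the set of probability densities on $\mathbb{R}$ that are continuous and strictly positive on an open interval and vanish outside it. $F(x,t)=\int_{-\infty}^{x}f(y,t)\,dy$, $F_{0}=F(\cdot,0)$; the median $m$ is defined by $F_{0}(m)=\tfrac12$. The canonical operator is $\rho[f]=2\sin^{2}(\pi F)f$, so the flow is $\partial_{t}f=\rho[f]-f$, equivalently $\partial_{t}F=-\sin(2\pi F)/(2\pi)$. It has a unique global mild solution in $L^{1}(\mathbb{R})$ among probability densities for every initial probability density, and the regions $F<\tfrac12$, $F=\tfrac12$, $F>\tfrac12$ are invariant (so the tangent is inverted on the corresponding branch, with value $\infty$ at $F=\tfrac12$). $H(f)=-\int f\log f$. $\mathrm{Cauchy}(m,\gamma)$ has density $\frac{\gamma}{\pi[(x-m)^{2}+\gamma^{2}]}$. *)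

(* Defs.v *)
From HB Require Import structures.
From mathcomp Require Import all_boot all_order all_algebra.
From mathcomp Require Import all_classical all_reals all_analysis.

Set Implicit Arguments.
Unset Strict Implicit.
Unset Printing Implicit Defensive.

Import Order.TTheory GRing.Theory Num.Theory.
Import numFieldNormedType.Exports.

Local Open Scope classical_set_scope.
Local Open Scope ring_scope.

Definition is_density (R : realType) (f : R -> R) : Prop :=
  [/\ measurable_fun setT f,
      (forall x, 0 <= f x)
    & (\int[@lebesgue_measure R]_x (f x)%:E = 1)%E].

(* The class D_+. The interval may be unbounded; it is nonempty because the
   total mass is 1. *)
Definition is_density_Dplus (R : realType) (f : R -> R) : Prop :=
  is_density f /\
  exists I : set R,
    [/\ open I, is_interval I,
        (forall x, I x -> 0 < f x /\ {for x, continuous f})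
      & (forall x, ~ I x -> f x = 0)].

Definition distr_fun (R : realType) (f : R -> R) (x : R) : R :=
  \int[@lebesgue_measure R]_(y in `]-oo, x]) f y.

Definition rho (R : realType) (f : R -> R) : R -> R :=
  fun x => 2 * sin (pi * distr_fun f x) ^+ 2 * f x.

(* Global mild solutions in L^1(R), among probability densities, of
     d/dt f = rho[f] - f = (2 sin^2(pi F) - 1) f,   f(., 0) = f0.
   A curve in C([0, +oo[; L^1) is given by a jointly measurable representative
   (t, x) |-> f t x, so that the L^1-valued integral of rho[f_s] - f_s over
   [0, t] is, for almost every x, the integral in s of the values at x (these
   are s-integrable for almost every x by Fubini, since |rho[f] - f| <= f).
   The equation at t = 0 is the initial condition, as an identity in L^1.
   Values of f at negative times are irrelevant. *)
Definition mild_solution (R : realType) (f0 : R -> R) (f : R -> R -> R) : Prop :=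
  [/\ measurable_fun (`[0, +oo[ `*` setT : set (R * R)) (fun p : R * R => f p.1 p.2),
      (forall t : R, 0 <= t -> is_density (f t)),
      (forall t : R, 0 <= t ->
         (\int[@lebesgue_measure R]_x `|f s x - f t x|%:E)%E
           @[s --> within [set s | 0 <= s] (nbhs t)] --> 0%E)
    & (forall t : R, 0 <= t ->
         {ae @lebesgue_measure R, forall x,
            f t x = f0 x
              + \int[@lebesgue_measure R]_(s in `[0, t]) (rho (f s) x - f s x)})].

(* Derivative at t of a function on [0, +oo[: two-sided if 0 < t, and the right
   derivative if t = 0. *)
Definition has_deriv_at (R : realType) (v : R -> R) (t l : R) : Prop :=
  h^-1 * (v (t + h) - v t) @[h --> within [set h | 0 <= t + h] (0 : R)^'] --> l.

(* The tangent with value infinity at its poles; in the library tan takes the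
   junk value 0 there. On pi * [0, 1] the only pole is pi / 2. *)
Definition etan (R : realType) (y : R) : \bar R :=
  if cos y == 0 then +oo%E else (tan y)%:E.

(* H(f) as an extended real; f ln f vanishes where f does, as ln 0 = 0. *)
Definition entropy (R : realType) (f : R -> R) : \bar R :=
  (- \int[@lebesgue_measure R]_x (f x * ln (f x))%:E)%E.

Definition finite_log_moment (R : realType) (f : R -> R) : Prop :=
  (\int[@lebesgue_measure R]_x (`|ln (f x)| * f x)%:E < +oo)%E.

Definition cauchy_density (R : realType) (m g : R) (x : R) : R :=
  g / (pi * ((x - m) ^+ 2 + g ^+ 2)).

Definition has_density (d : measure_display) (T : measurableType d)
    (R : realType) (P : probability T R) (X : {RV P >-> R}) (f : R -> R) : Prop :=
  forall A : set R, measurable A ->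
    distribution P X A = (\int[@lebesgue_measure R]_(x in A) (f x)%:E)%E.

(* Convergence in distribution, as t -> +oo, to the law with distribution
   function G: the distribution functions converge at the continuity points of
   G. The variables may live on different probability spaces. *)
Definition cvg_in_distribution (R : realType) (d : R -> measure_display)
    (T : forall t, measurableType (d t)) (P : forall t, probability (T t) R)
    (Y : forall t, T t -> R) (G : R -> R) : Prop :=
  forall y : R, {for y, continuous G} ->
    P t [set w | Y t w <= y] @[t --> +oo%R] --> (G y)%:E.

(* Main.v *)
Require Import Defs.
From HB Require Import structures.
From mathcomp Require Import all_boot all_order all_algebra.
From mathcomp Require Import all_classical all_reals all_analysis.
From mathcomp Require Import measurable_realfun ring lra.

Import Order.TTheory GRing.Theory Num.Theory.
Import numFieldNormedType.Exports.

Local Open Scope classical_set_scope.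
Local Open Scope ring_scope.

Set Implicit Arguments.
Unset Strict Implicit.
Unset Printing Implicit Defensive.

(** The distribution functions of the flow decouple: for each x, the number
    F(x,t) solves an autonomous scalar equation. Indeed F(.,t) pushes the
    measure f_t dx to the uniform measure on [0,1] ([integral_distr_fun]), so
    that integrating (2 sin^2 (pi F) - 1) f over ]-oo, x] amounts to
    integrating 2 sin^2 (pi u) - 1 over [0, F(x,t)], which gives
    - sin (2 pi F) / (2 pi). With Fubini's theorem the mild equation becomes
    the integral form of F' = - sin (2 pi F) / (2 pi)
    ([distr_fun_integral_eq]). This equation says that tan (pi F) decays like
    exp (- t). To avoid the pole of the tangent one follows instead
    W = sin (pi F) cos (pi F_0) - e^-t cos (pi F) sin (pi F_0), which vanishes
    at t = 0 and satisfies W' = - cos^2 (pi F) W, hence vanishes identically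
    ([angle_ode_invariant]). Consequently F(.,t) = T_e o F_0 with e = e^-t,
    where T_e is the increasing bijection of [0,1] defined by
    tan (pi T_e(u)) = e tan (pi u) ([mild_distr_funE]), and differentiation
    gives f_t = T_e'(F_0) f_0 almost everywhere ([mild_densityE]).

    Near the median, F_0(m + e y) = 1/2 + e f_0(m) y + o(e), and T_e magnifies
    a neighbourhood of 1/2 of size e to unit size. In the limit this
    produces 1/2 + atan (pi f_0(m) y) / pi, which is a Cauchy distribution
    function ([cvg_flow_map_median]).

    For the entropy write f_t = a(F_0) f_0 with a = T_e'. Since F_0 is uniform
    under f_0 dx, - H(f_t) splits into the integral of a ln a over [0,1], which
    does not depend on f_0, and the mean of ln f_0 under f_t
    ([entropy_split]). The substitution v = T_e(u) turns the first integral
    into a log-sine integral, whose exact value is t + 2 ln ((1 + e^-t) / 2)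
    ([Rintegral_flow_slope_ln]). The second term tends to ln f_0(m), because
    f_t concentrates at m while remaining, off any neighbourhood of m, below
    any small multiple of f_0 ([concentration_median]). Hence
    H(f_t) + t -> 2 ln 2 - ln f_0(m) ([cvg_mild_entropy]).

    The iteration of rho has the same structure, with T_e replaced by the
    iterates of T(u) = u - sin (2 pi u) / (2 pi), whose slope is
    2 sin^2 (pi u). By the chain rule the first term of the splitting grows at
    step n by the mean of ln T'(F_0) under f_(n+1), which tends to
    ln T'(1/2) = ln 2, again by concentration at the median
    ([cvg_iter_entropy_step]).

    The entropy of the Cauchy law comes from the limit e = 0 of the same
    log-sine integral, as the Cauchy density is sin^2 (pi G) / (pi g) in terms
    of its own distribution function G ([entropy_cauchy]). *)

(** * Measures with a density *)
Section density_measure.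
Context {R : realType}.
Local Notation mu := (@lebesgue_measure R).

Definition density_measure (f : R -> R) (mf : measurable_fun setT f)
    (f0 : forall x, 0 <= f x) (A : set (measurableTypeR R)) : \bar R :=
  (\int[mu]_(x in A) (f x)%:E)%E.

Variables (f : R -> R) (mf : measurable_fun setT f) (f0 : forall x, 0 <= f x).
Let nu := density_measure mf f0.

Let nu0 : nu set0 = 0%E.
Proof. by rewrite /nu /density_measure integral_set0. Qed.

Let nu_ge0 A : (0 <= nu A)%E.
Proof. by apply: integral_ge0 => x _; rewrite lee_fin. Qed.

Let nu_sigma_additive : semi_sigma_additive nu.
Proof.
move=> A mA tA mUA; rewrite /nu /density_measure ge0_integral_bigcup//=.
- apply: is_cvg_ereal_nneg_natsum_cond => n _ _.
  by apply: integral_ge0 => x _; rewrite lee_fin.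
- by apply: measurable_funTS; apply/measurable_EFinP.
- by move=> x _; rewrite lee_fin.
Qed.

HB.instance Definition _ := isMeasure.Build _ _ _
  (density_measure mf f0) nu0 nu_ge0 nu_sigma_additive.

Import HBNNSimple.

Let integral_density_nnsfun (h : {nnsfun measurableTypeR R >-> R}) :
  (\int[nu]_x (h x)%:E = \int[mu]_x (h x * f x)%:E)%E.
Proof.
under [LHS]eq_integral do rewrite fimfunE -fsumEFin//.
rewrite [LHS]ge0_integral_fsum//; last 2 first.
  - by move=> r; exact/measurable_EFinP/measurableT_comp.
  - by move=> n x _; rewrite EFinM nnfun_muleindic_ge0.
under [RHS]eq_integral.
  move=> x xD; rewrite fimfunE EFinM -fsumEFin// ge0_mule_fsuml; last first.
    by move=> r; rewrite EFinM nnfun_muleindic_ge0.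
  over.
rewrite [RHS]ge0_integral_fsum//; last 2 first.
  - move=> r; apply: emeasurable_funM; last exact/measurable_EFinP.
    by apply/measurable_EFinP/measurableT_comp.
  - by move=> n x _; apply: mule_ge0; rewrite ?lee_fin// -lee_fin EFinM nnfun_muleindic_ge0.
apply: eq_fsbigr => r; rewrite inE => -[x _ hxr].
have r0 : 0 <= r by rewrite -hxr.
rewrite integralZl_indic_nnsfun// integral_indic// setIT /nu.
under [RHS]eq_integral do rewrite EFinM -muleA.
rewrite [RHS]ge0_integralZl//=.
- rewrite /density_measure integral_mkcond; congr (_ * _)%E.
  apply: eq_integral => y _.
  by rewrite patchE indicE; case: ifPn => _; rewrite ?mul1e ?mul0e.
- by apply: emeasurable_funM; exact/measurable_EFinP.
- by move=> y _; rewrite mule_ge0 ?lee_fin.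
Qed.

(** Monotone approximation by simple functions reduces this to indicators. *)
Lemma ge0_integral_density (g : R -> R) :
  measurable_fun setT g -> (forall x, 0 <= g x) ->
  (\int[density_measure mf f0]_x (g x)%:E = \int[mu]_x (g x * f x)%:E)%E.
Proof.
move=> mg g0.
have mEg : measurable_fun (setT : set (measurableTypeR R)) (EFin \o g).
  exact/measurable_EFinP.
pose h := nnsfun_approx measurableT mEg.
have cvgh x : (h n x)%:E @[n --> \oo] --> (g x)%:E.
  by apply: cvg_nnsfun_approx => // y _; rewrite lee_fin.
transitivity (limn (fun n => \int[nu]_x (h n x)%:E)%E).
  rewrite -monotone_convergence//=.
  - by apply: eq_integral => x _; apply/esym/cvg_lim => //; exact: cvgh.
  - by move=> n; exact/measurable_EFinP.
  - by move=> n x _; rewrite lee_fin.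
  - by move=> x _ a b ab; rewrite lee_fin//; exact/lefP/nd_nnsfun_approx.
under eq_fun do rewrite integral_density_nnsfun.
rewrite -monotone_convergence//=.
- apply: eq_integral => x _; apply/cvg_lim => //=.
  under eq_fun do rewrite EFinM; rewrite EFinM.
  by apply: cvgeZr => //; exact: cvgh.
- by move=> n; apply/measurable_EFinP; exact: measurable_funM.
- by move=> n x _; rewrite lee_fin mulr_ge0.
- move=> x _ a b ab; rewrite lee_fin ler_wpM2r//.
  exact/lefP/nd_nnsfun_approx.
Qed.

End density_measure.

Lemma measure_eq_ocitv {R : realType}
    (m1 m2 : {measure set (measurableTypeR R) -> \bar R}) :
  (forall a b, m1 `]a, b]%classic = m2 `]a, b]%classic) ->
  (forall a b, m1 `]a, b]%classic < +oo)%E ->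
  forall A, measurable A -> m1 A = m2 A.
Proof.
move=> m12 m1oo A mA.
apply: (@g_sigma_algebra_measure_unique _ R (measurableTypeR R) (@ocitv R) _
  (fun k => `](- k%:R), k%:R]%classic)) => //.
- by move=> B ?; exact: sub_sigma_algebra.
- by move=> i; exact: is_ocitv.
- apply/seteqP; split => // x _; near \oo => n; exists n => //=.
  rewrite in_itv/=; apply/andP; split.
    by rewrite ltrNl; near: n; exact: nbhs_infty_gtr.
  by near: n; exact: nbhs_infty_ger.
- exact: ocitvI.
- by move=> B [[a b] _ <-].
Unshelve. all: by end_near. Qed.

(** A half-open interval is a difference of two rays, and those intervals form
    a generating pi-system. *)
Lemma measure_eq_ray {R : realType}
    (m1 m2 : {measure set (measurableTypeR R) -> \bar R}) :
  (forall a, m1 `]-oo, a]%classic = m2 `]-oo, a]%classic) ->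
  (forall a, m1 `]-oo, a]%classic < +oo)%E ->
  forall A, measurable A -> m1 A = m2 A.
Proof.
move=> m12 m1oo; apply: measure_eq_ocitv => a b.
  have -> : `]a, b]%classic = `]-oo, b] `\` `]-oo, a] :> set (measurableTypeR R).
    by rewrite -[RHS]setCK setCD setCitvl setUC -[LHS]setCK setCitv.
  have [ab|ba] := leP a b.
    have sub : (`]-oo, a]%classic : set (measurableTypeR R)) `<=`
        `]-oo, b]%classic by exact: subset_itvl.
    have mD (m : {measure set (measurableTypeR R) -> \bar R}) :
        (m `]-oo, b]%classic < +oo)%E ->
        m (`]-oo, b] `\` `]-oo, a]) = (m `]-oo, b]%classic - m `]-oo, a]%classic)%E.
      by move=> moo; rewrite measureD ?(setIidr sub)//; exact: measurable_itv.
    rewrite (mD m1)// (mD m2); first by rewrite !m12.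
    by have := m1oo b; rewrite m12.
  rewrite (_ : _ `\` _ = set0) ?measure0//; apply/seteqP; split => // x/=.
  by rewrite !in_itv/= => -[xb /negP]; rewrite (le_trans xb (ltW ba)).
apply: le_lt_trans (m1oo b); apply: le_measure; rewrite ?inE//.
exact: subset_itvr.
Qed.

(** * Distribution functions *)
Section distribution_function.
Context {R : realType}.
Local Notation mu := (@lebesgue_measure R).
Variables (f : R -> R) (f0 : forall x, 0 <= f x).
Hypothesis fi : mu.-integrable setT (EFin \o f).
Local Notation F := (distr_fun f).
Local Notation M := (\int[mu]_x f x).

Lemma integrable_measurable : measurable_fun setT f.
Proof. by apply/measurable_EFinP; exact: measurable_int fi. Qed.
Let mf := integrable_measurable.

Let fiS (A : set R) : measurable A -> mu.-integrable A (EFin \o f).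
Proof. by move=> mA; apply: integrableS fi. Qed.

Lemma EFin_distr_fun x : (F x)%:E = (\int[mu]_(y in `]-oo, x]) (f y)%:E)%E.
Proof. by rewrite /distr_fun /Rintegral fineK//; apply/integrable_fin_num/fiS. Qed.

Lemma distr_funB a b : a <= b -> F b - F a = \int[mu]_(y in `]a, b]) f y.
Proof. by move=> ab; rewrite Rintegral_itvB//; exact: fiS. Qed.

Lemma distr_fun_ge0 x : 0 <= F x.
Proof. exact: Rintegral_ge0. Qed.

Lemma distr_fun_homo : {homo F : x y / x <= y}.
Proof. by move=> x y xy; rewrite -subr_ge0 distr_funB// Rintegral_ge0. Qed.

Lemma distr_fun_le x : F x <= M.
Proof.
rewrite -lee_fin EFin_distr_fun /Rintegral fineK ?integrable_fin_num//.
by apply: ge0_subset_integral => //; [exact/measurable_EFinP|move=> y _; rewrite lee_fin].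
Qed.

Lemma continuous_distr_fun : continuous F.
Proof.
move=> x; apply/cvgrPdist_lt => e e0.
have [d [d0 /= dP]] := integral_normr_continuous fi e0.
have main a b : a <= b -> b - a < d -> `|F b - F a| < e.
  move=> ab abd; rewrite distr_funB// ger0_norm ?Rintegral_ge0//.
  rewrite (_ : Rintegral _ _ _ = \int[mu]_(y in `]a, b]) `|f y|).
    apply: dP => //.
    by rewrite lebesgue_measure_itv/= lte_fin; case: ifPn.
  by apply: eq_Rintegral => y _; rewrite ger0_norm.
near=> y; have [xy|yx] := leP x y.
  rewrite distrC; apply: main => //; apply: le_lt_trans (ler_norm _) _.
  by rewrite distrC; near: y; exists d.
apply: main; first exact: ltW.
by apply: le_lt_trans (ler_norm _) _; near: y; exists d.
Unshelve. all: by end_near. Qed.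

Lemma measurable_distr_fun : measurable_fun setT F.
Proof. exact: continuous_measurable_fun continuous_distr_fun. Qed.

Lemma distr_fun_cvgNy : F (- n%:R) @[n --> \oo] --> 0.
Proof.
apply: fine_cvg.
have : density_measure mf f0 \o (fun n => `]-oo, (- n%:R)]%classic) @ \oo
    --> density_measure mf f0 (\bigcap_n `]-oo, (- n%:R)]%classic).
  apply: nonincreasing_cvg_mu => //.
  - by have := ltry (F (- 0%:R)); rewrite EFin_distr_fun.
  - exact: bigcapT_measurable.
  - move=> m n mn; apply/subsetPset/subset_itvl.
    by rewrite bnd_simp lerN2 ler_nat.
rewrite [X in density_measure _ _ X](_ : _ = set0) ?measure0//.
rewrite -subset0 => x /= xn; near \oo => n.
have := xn n I; rewrite /= in_itv/= leNgt => /negP; apply.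
by rewrite ltrNl; near: n; exact: nbhs_infty_gtr.
Unshelve. all: by end_near. Qed.

Lemma distr_fun_cvgy : F n%:R @[n --> \oo] --> M.
Proof.
apply: fine_cvg; rewrite fineK ?integrable_fin_num//.
have : density_measure mf f0 \o (fun n => `]-oo, (n%:R)]%classic) @ \oo
    --> density_measure mf f0 (\bigcup_n `]-oo, (n%:R)]%classic).
  apply: nondecreasing_cvg_mu => //.
  - exact: bigcupT_measurable.
  - move=> m n mn; apply/subsetPset/subset_itvl.
    by rewrite bnd_simp ler_nat.
rewrite [X in density_measure _ _ X](_ : _ = setT)//.
apply/seteqP; split => // x _; near \oo => n; exists n => //=.
by rewrite in_itv/=; near: n; exact: nbhs_infty_ger.
Unshelve. all: by end_near. Qed.

Lemma distr_fun_surj a : 0 < a < M -> exists x, F x = a.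
Proof.
move=> /andP[a0 aM].
have [x Fx] : exists x, F x < a.
  near \oo => n; exists (- n%:R); near: n.
  exact: (cvgr_lt _ distr_fun_cvgNy).
have [y Fy] : exists y, a < F y.
  near \oo => n; exists (n%:R); near: n.
  exact: (cvgr_gt _ distr_fun_cvgy).
have xy : x <= y.
  by rewrite leNgt; apply/negP => /ltW/distr_fun_homo; move: Fx Fy; lra.
have [||z _ <-] := @IVT R F x y a xy; last by exists z.
  exact/continuous_subspaceT/continuous_distr_fun.
by rewrite min_l ?max_r ?distr_fun_homo ?(ltW Fx) ?(ltW Fy).
Unshelve. all: by end_near. Qed.

End distribution_function.

(** * A density is uniformly distributed in the scale of its distribution function *)
Section pushforward_uniform.
Context {R : realType}.
Local Notation mu := (@lebesgue_measure R).
Variables (f : R -> R) (f0 : forall x, 0 <= f x).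
Hypothesis fi : mu.-integrable setT (EFin \o f).
Local Notation F := (distr_fun f).
Local Notation M := (\int[mu]_x f x).
Let mf : measurable_fun setT f := integrable_measurable fi.
Let F0 x : 0 <= F x := distr_fun_ge0 f0 x.
Let FM x : F x <= M := distr_fun_le f0 fi x.
Let mEf (A : set R) : measurable_fun A (EFin \o f).
Proof. by apply: measurable_funTS; apply/measurable_EFinP. Qed.
Let mF : measurable_fun setT F := measurable_distr_fun f0 fi.
Let fE : (\int[mu]_x (f x)%:E)%E = M%:E.
Proof. by rewrite /Rintegral fineK// integrable_fin_num. Qed.

Let mS a : measurable [set x | F x <= a].
Proof.
have -> : [set x | F x <= a] = setT `&` F @^-1` `]-oo, a]%classic.
  by apply/seteqP; split => x /=; rewrite in_itv/=; [|case].
exact: mF.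
Qed.

(** As F may be constant on intervals, the sublevel set is squeezed between the
    rays that end where F takes the value a and where it takes a slightly
    larger one; both values are attained by continuity. *)
Lemma integral_distr_fun_sublevel a :
  (\int[mu]_(x in [set x | (F x <= a)%R]) (f x)%:E = (Num.max 0 (Num.min a M))%:E)%E.
Proof.
have M0 : 0 <= M by exact: Rintegral_ge0.
have [a0|a0] := ltP a 0.
  rewrite max_l; last by rewrite ge_min (ltW a0).
  rewrite (_ : [set _ | _] = set0) ?integral_set0// -subset0 => x /=.
  by have := F0 x; lra.
have [Ma|aM] := leP M a.
  rewrite max_r// (_ : [set _ | _] = setT) ?fE//.
  by apply/seteqP; split => // x _ /=; rewrite (le_trans (FM x)).
rewrite max_r//; apply/eqP; rewrite eq_le; apply/andP; split.
  apply/lee_addgt0Pr => e e0.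
  have [|z Fz] := @distr_fun_surj R f f0 fi (Num.min (a + e) ((a + M) / 2)).
    by rewrite lt_min gt_min; apply/andP; split; [apply/andP; split|apply/orP; right]; lra.
  apply: (@le_trans _ _ (\int[mu]_(x in `]-oo, z]) (f x)%:E)%E).
    apply: ge0_subset_integral; [exact: mS|by []|exact: mEf| |].
      by move=> x _; rewrite lee_fin.
    move=> x /= Fx; rewrite in_itv/= leNgt; apply/negP => /ltW.
    move=> /(distr_fun_homo f0 fi); rewrite Fz ge_min => /orP[]; lra.
  by rewrite -EFin_distr_fun// Fz -EFinD lee_fin ge_min lexx.
case: (ltgtP 0 a) a0 => // [a_gt0|<-] _; last first.
  by apply: integral_ge0 => x _; rewrite lee_fin.
have [|z Fz] := @distr_fun_surj R f f0 fi a; first by rewrite a_gt0.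
rewrite -[in leLHS]Fz EFin_distr_fun//.
apply: ge0_subset_integral; [by []|exact: mS|exact: mEf| |].
  by move=> x _; rewrite lee_fin.
by move=> x /=; rewrite in_itv/= -Fz; exact: distr_fun_homo.
Qed.

(* the uniform measure on [0, M] as a measure with a density *)
Let m01 : measurable_fun setT (\1_(`[0, M]%classic : set R) : R -> R).
Proof. exact: measurable_indic. Qed.
Let ge01 x : 0 <= (\1_(`[0, M]%classic : set R) : R -> R) x.
Proof. by []. Qed.

Let pushforward_uniform (A : set (measurableTypeR R)) : measurable A ->
  pushforward (density_measure mf f0) (F : R -> measurableTypeR R) A =
  density_measure m01 ge01 A.
Proof.
have pE a : pushforward (density_measure mf f0) (F : R -> measurableTypeR R)
    `]-oo, a]%classic = (Num.max 0 (Num.min a M))%:E.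
  rewrite -integral_distr_fun_sublevel /pushforward /density_measure.
  by congr integral; apply/seteqP; split => x /=; rewrite in_itv.
apply: measure_eq_ray => a; last by rewrite /= pE ltry.
rewrite /= pE /density_measure integral_indic//.
have M0 : 0 <= M by exact: Rintegral_ge0.
rewrite (_ : _ `&` _ = `[0, Num.min a M]%classic).
  rewrite /= lebesgue_measure_itv/= lte_fin.
  by case: ltP => h; rewrite ?sube0 -?EFinB ?subr0.
by apply/seteqP; split => x /=; rewrite !in_itv/= le_min;
  [move=> [/andP[-> ->] ->]|move=> /and3P[-> -> ->]].
Qed.

Let ge0_pushforward (phi : R -> R) : measurable_fun setT phi ->
  (forall u, 0 <= phi u) ->
  (\int[mu]_x (phi (F x) * f x)%:E = \int[mu]_(u in `[0%R, M]) (phi u)%:E)%E.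
Proof.
move=> mphi phi0.
rewrite -(@ge0_integral_density _ f mf f0 (phi \o F)); last 2 first.
- exact: measurableT_comp mphi mF.
- by move=> x; exact: phi0.
have := @ge0_integral_pushforward _ _ (measurableTypeR R) (measurableTypeR R) R F mF
  (density_measure mf f0) setT (EFin \o phi).
rewrite preimage_setT => /(_ measurableT) <-//; last 2 first.
- exact/measurable_EFinP.
- by move=> y _; rewrite lee_fin.
rewrite (eq_measure_integral (density_measure m01 ge01)).
  rewrite ge0_integral_density// [RHS]integral_mkcond.
  apply: eq_integral => x _; rewrite patchE indicE.
  by case: ifPn => _; rewrite ?mulr1 ?mulr0.
by move=> A mA _; exact: pushforward_uniform.
Qed.

(** Both sides integrate phi: the left one against the image of f dx under F,
    the right one against the uniform measure on [0, M]. These measures agree on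
    rays by [integral_distr_fun_sublevel]. *)
Lemma integral_distr_fun (phi : R -> R) : measurable_fun setT phi ->
  (\int[mu]_x (phi (F x) * f x)%:E = \int[mu]_(u in `[0%R, M]) (phi u)%:E)%E.
Proof.
move=> mphi; rewrite integralE [RHS]integralE; congr (_ - _)%E.
- have := @ge0_pushforward (phi^\+) (measurable_funrpos mphi) (@funrpos_ge0 _ _ _).
  have -> : (\int[mu]_x (phi^\+ (F x) * f x)%:E =
      \int[mu]_x ((fun x => (phi (F x) * f x)%:E)^\+ x))%E.
    apply: eq_integral => x _; rewrite funeposE /funrpos/= -EFin_max.
    by rewrite maxr_pMl// mul0r.
  by move=> ->; apply: eq_integral => x _; rewrite funeposE /funrpos/= EFin_max.
- have := @ge0_pushforward (phi^\-) (measurable_funrneg mphi) (@funrneg_ge0 _ _ _).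
  have -> : (\int[mu]_x (phi^\- (F x) * f x)%:E =
      \int[mu]_x ((fun x => (phi (F x) * f x)%:E)^\- x))%E.
    apply: eq_integral => x _; rewrite funenegE /funrneg/= -EFin_max.
    by rewrite maxr_pMl// mul0r mulNr.
  by move=> ->; apply: eq_integral => x _; rewrite funenegE /funrneg/= EFin_max.
Qed.

End pushforward_uniform.

(** * The chain rule for distribution functions *)
Section chain_rule.
Context {R : realType}.
Local Notation mu := (@lebesgue_measure R).

Lemma derivable_LRcontinuous (F : R -> R) (a b : R) : (forall x, derivable F x 1) ->
  derivable_oo_LRcontinuous F a b.
Proof.
move=> dF; have cF x : {for x, continuous F}.
  exact/differentiable_continuous/derivable1_diffP.
split; first by move=> x _; exact: dF.
- exact/cvg_at_right_filter/cF.
- exact/cvg_at_left_filter/cF.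
Qed.

Lemma integral_derive (Phi phi : R -> R) a b : a <= b ->
  (forall x, is_derive x (1 : R) Phi (phi x)) -> continuous phi ->
  (\int[mu]_(u in `[a, b]) (phi u)%:E = (Phi b - Phi a)%:E)%E.
Proof.
rewrite le_eqVlt => /predU1P[->|ab] dPhi cphi.
  by rewrite set_itv1 integral_set1 subrr.
rewrite (@continuous_FTC2 R phi Phi a b) ?EFinB//.
- exact: continuous_subspaceT.
- by apply: derivable_LRcontinuous => x; have [] := dPhi x.
- by move=> x _; rewrite derive1E; apply: derive_val.
Qed.

Lemma integrable_bounded_mul (g f : R -> R) (C : R) :
  measurable_fun setT g -> (forall x, `|g x| <= C) ->
  mu.-integrable setT (EFin \o f) ->
  mu.-integrable setT (fun x => (g x * f x)%:E).
Proof.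
move=> mg gC fi; have mf := integrable_measurable fi.
have C0 : 0 <= C := le_trans (normr_ge0 _) (gC 0).
apply: (@le_integrable _ _ _ mu _ measurableT _ (fun x => (C * f x)%:E)).
- by apply/measurable_EFinP; exact: measurable_funM.
- move=> x _; rewrite !abse_EFin lee_fin !normrM (ger0_norm C0).
  by rewrite ler_wpM2r.
- by under eq_fun do rewrite EFinM; exact: integrableZl.
Qed.

Variables (f : R -> R) (f0 : forall x, 0 <= f x).
Hypothesis fi : mu.-integrable setT (EFin \o f).
Local Notation F := (distr_fun f).

(** The restriction of f to ]-oo, x] has total mass F x and, on this ray, the
    same distribution function; so [integral_distr_fun] applies to it. *)
Lemma integral_distr_fun_ray (phi : R -> R) x : measurable_fun setT phi ->
  (\int[mu]_(y in `]-oo, x]) (phi (F y) * f y)%:E =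
   \int[mu]_(u in `[0%R, F x]) (phi u)%:E)%E.
Proof.
move=> mphi; pose A := `]-oo, x]%classic : set R; pose g := f \_ A.
have g0 y : 0 <= g y by rewrite /g patchE; case: ifPn.
have gi : mu.-integrable setT (EFin \o g).
  rewrite /g -restrict_EFin; apply/integrable_restrict => //.
    exact: measurable_itv.
  by rewrite setTI; apply: integrableS fi => //; exact: measurable_itv.
have gE : (\int[mu]_z (g z))%R = F x.
  by rewrite /distr_fun [RHS]Rintegral_mkcond.
have GE y : y <= x -> distr_fun g y = F y.
  move=> yx; rewrite /distr_fun; apply: eq_Rintegral => z.
  rewrite inE/= in_itv/= => zy; rewrite /g patchE mem_set// /A/= in_itv/=.
  exact: le_trans yx.
have := integral_distr_fun g0 gi mphi; rewrite gE => <-.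
rewrite integral_mkcond; apply: eq_integral => y _.
rewrite patchE; have [yx|yx] := boolP (y \in _).
  rewrite GE; last by move: yx; rewrite inE/= in_itv.
  by rewrite /g patchE yx.
by rewrite /g patchE (negbTE yx) mulr0.
Qed.

(** The integrated form of (Phi o F)' = phi(F) f. It goes through the pushforward
    by F and so asks for no continuity of f. *)
Lemma Rintegral_distr_fun_chain (Phi phi : R -> R) x :
  (forall x, is_derive x (1 : R) Phi (phi x)) -> continuous phi ->
  \int[mu]_(y in `]-oo, x]) (phi (F y) * f y) = Phi (F x) - Phi 0.
Proof.
move=> dPhi cphi; rewrite /Rintegral integral_distr_fun_ray.
  by rewrite (integral_derive _ dPhi)// distr_fun_ge0.
exact: continuous_measurable_fun.
Qed.

End chain_rule.

(** * Probability densities *)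

(** Equal distribution functions give equal measures, hence equal integrals over
    every measurable set. *)
Lemma density_eq_ae {R : realType} (f g : R -> R) :
  (forall x, 0 <= f x) -> (forall x, 0 <= g x) ->
  (@lebesgue_measure R).-integrable setT (EFin \o f) ->
  (@lebesgue_measure R).-integrable setT (EFin \o g) ->
  distr_fun f =1 distr_fun g -> {ae @lebesgue_measure R, forall x, f x = g x}.
Proof.
move=> f0 g0 fi gi FG.
have mf := integrable_measurable fi; have mg := integrable_measurable gi.
have : ae_eq (@lebesgue_measure R) setT (EFin \o f) (EFin \o g).
  apply: integral_ae_eq => //; first exact/measurable_EFinP.
  move=> E _ mE; apply: (@measure_eq_ray R (density_measure mf f0) (density_measure mg g0)) => //.
    move=> a; rewrite /= /density_measure.
    by rewrite -(EFin_distr_fun fi) -(EFin_distr_fun gi) FG.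
  by move=> a; rewrite /= /density_measure -(EFin_distr_fun fi) ltry.
by apply: filterS => x /(_ I) [].
Qed.

Lemma is_density_integrable {R : realType} (f : R -> R) : is_density f ->
  (@lebesgue_measure R).-integrable setT (EFin \o f).
Proof.
move=> [mf f0 f1]; apply/integrableP; split; first exact/measurable_EFinP.
under eq_integral do rewrite /= ger0_norm//.
by rewrite f1 ltry.
Qed.

Lemma is_density_mass {R : realType} (f : R -> R) : is_density f ->
  \int[@lebesgue_measure R]_x f x = 1.
Proof. by move=> [_ _]; rewrite /Rintegral => ->. Qed.

Lemma is_density_distr_fun_itv {R : realType} (f : R -> R) x : is_density f ->
  0 <= distr_fun f x <= 1.
Proof.
move=> df; have [_ f0 _] := df; rewrite distr_fun_ge0//=.
by rewrite -(is_density_mass df) distr_fun_le//; exact: is_density_integrable.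
Qed.

Lemma distr_fun_dist_le {R : realType} (f g : R -> R) x :
  is_density f -> is_density g ->
  (`|distr_fun f x - distr_fun g x|%:E
    <= \int[@lebesgue_measure R]_x `|f x - g x|%:E)%E.
Proof.
move=> df dg; have fi := is_density_integrable df; have gi := is_density_integrable dg.
have fgi : (@lebesgue_measure R).-integrable setT (EFin \o (fun x => f x - g x)).
  rewrite (_ : _ \o _ = (EFin \o f) \- (EFin \o g))%E; first exact: integrableB.
  by apply/funext => y /=; rewrite EFinB.
rewrite -RintegralB//; try by [apply: integrableS fi|apply: integrableS gi].
rewrite EFin_normr_Rintegral//; last by apply: integrableS fgi.
apply: le_trans (le_abse_integral _ _ _) _ => //.
  by apply: measurable_funTS; exact: measurable_int fgi.
apply: ge0_subset_integral => //.
by apply/measurable_EFinP/measurableT_comp => //; exact: integrable_measurable fgi.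
Qed.

Section density_pushforward.
Context {R : realType}.
Local Notation mu := (@lebesgue_measure R).
Variables (f : R -> R) (df : is_density f).
Local Notation F := (distr_fun f).

Lemma integral_density_distr_fun (phi : R -> R) : measurable_fun setT phi ->
  (\int[mu]_x (phi (F x) * f x)%:E = \int[mu]_(u in `[0%R, 1%R]) (phi u)%:E)%E.
Proof.
have [_ f0 _] := df; move=> mphi.
by rewrite (integral_distr_fun f0 (is_density_integrable df) mphi) (is_density_mass df).
Qed.

Lemma integrable_density_distr_fun (phi : R -> R) : measurable_fun setT phi ->
  mu.-integrable `[0, 1] (EFin \o phi) ->
  mu.-integrable setT (fun x => (phi (F x) * f x)%:E).
Proof.
move=> mphi /integrableP[_ iphi]; have [mf f0 _] := df; apply/integrableP; split.
  apply/measurable_EFinP; apply: measurable_funM => //.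
  apply: (measurableT_comp mphi); apply: measurable_distr_fun => //.
  exact: is_density_integrable.
have mnphi : measurable_fun setT (fun u => `|phi u|) by exact: measurableT_comp mphi.
have := integral_density_distr_fun mnphi.
under eq_integral do rewrite -[X in _ * X](ger0_norm (f0 _)) -normrM -abse_EFin.
by move=> ->.
Qed.

Lemma continuous_integrable01 (phi : R -> R) : continuous phi ->
  mu.-integrable `[0, 1] (EFin \o phi).
Proof.
move=> cphi; apply: continuous_compact_integrable; first exact: segment_compact.
exact: continuous_subspaceT.
Qed.

Lemma Rintegral_density_distr_fun (phi : R -> R) : measurable_fun setT phi ->
  \int[mu]_x (phi (F x) * f x) = \int[mu]_(u in `[0, 1]) phi u.
Proof. by move=> mphi; rewrite /Rintegral integral_density_distr_fun. Qed.

End density_pushforward.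

(** * The equation of the distribution functions along the flow *)
Lemma cos_2pi {R : realType} (v : R) :
  cos (2 * pi * v) = 1 - 2 * sin (pi * v) ^+ 2.
Proof.
rewrite (_ : 2 * pi * v = (pi * v) *+ 2); last by rewrite -mulrA mulr_natl.
by rewrite cos_mulr2n cos2sin2 mulr2n; ring.
Qed.

Lemma sin_2pi {R : realType} (v : R) :
  sin (2 * pi * v) = 2 * sin (pi * v) * cos (pi * v).
Proof.
rewrite (_ : 2 * pi * v = (pi * v) *+ 2); last by rewrite -mulrA mulr_natl.
by rewrite sin_mulr2n mulr2n; ring.
Qed.

Section mild_solution.
Context {R : realType}.
Local Notation mu := (@lebesgue_measure R).
Variables (f0 : R -> R) (f : R -> R -> R).
Hypotheses (df0 : is_density f0) (mildf : mild_solution f0 f).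

Let df t : 0 <= t -> is_density (f t).
Proof. by case: mildf => _ + _ _; exact. Qed.

(** Distribution functions are 1-Lipschitz in the density for the L^1 norm. *)
Lemma distr_fun_time_continuous (x t : R) : 0 <= t ->
  distr_fun (f s) x @[s --> within [set s | 0 <= s] (nbhs t)]
    --> distr_fun (f t) x.
Proof.
move=> t0; case: mildf => _ _ /(_ _ t0) /fine_cvgP[finL L0] _.
apply/cvgrPdist_lt => e e0; move/cvgrPdist_lt : L0 => /(_ _ e0) L0.
near=> s.
have s0 : 0 <= s by near: s; exact: withinT.
rewrite distrC -lte_fin (le_lt_trans (distr_fun_dist_le x (df s0) (df t0)))//.
rewrite -[ltLHS]fineK; last by near: s; exact: finL.
rewrite lte_fin (le_lt_trans (ler_norm _))// -normrN -sub0r.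
by near: s; exact: L0.
Unshelve. all: by end_near. Qed.

(* the solution, cut off at negative times to be measurable on the whole plane *)
Let ff : R * R -> R :=
  (fun p => f p.1 p.2) \_ ([set` `[0, +oo[] `*` setT).

Let mff : measurable_fun setT ff.
Proof.
case: mildf => mf _ _ _.
apply/(measurable_restrictT _ _).1 => //.
by apply: measurableX => //; exact: measurable_itv.
Qed.

Let ffE t x : 0 <= t -> ff (t, x) = f t x.
Proof. by move=> t0; rewrite /ff patchE mem_set//=; split => //=; rewrite in_itv/= t0. Qed.

Let ff_ge0 p : 0 <= ff p.
Proof.
rewrite /ff patchE; case: ifPn => //; rewrite inE/= in_itv/= andbT => -[p0 _].
by have [] := df p0.
Qed.

(* the distribution functions are jointly measurable, by Tonelli *)
Let measurable_distr_fun2 :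
  measurable_fun setT (fun p : R * R => distr_fun (fun y => ff (p.1, y)) p.2).
Proof.
pose A := [set q : (R * R) * R | q.2 <= q.1.2].
have mA : measurable A.
  have : measurable_fun setT (fun q : (R * R) * R => q.2 <= q.1.2).
    apply: measurable_fun_ler => //.
    exact: (measurableT_comp measurable_snd measurable_fst).
  by move=> /(_ measurableT [set true]); rewrite setTI; exact.
pose k (q : (R * R) * R) : \bar R := (ff (q.1.1, q.2) * \1_A q)%:E.
have mk : measurable_fun setT k.
  apply/measurable_EFinP; apply: measurable_funM.
    apply: (measurableT_comp mff) => //.
    apply/measurable_fun_pairP; split => //.
      exact: (measurableT_comp measurable_fst measurable_fst).
    exact: measurable_snd.
  exact: measurable_indic.
have k0 q : (0 <= k q)%E by rewrite lee_fin mulr_ge0.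
have := @measurable_fun_fubini_tonelli_F _ _ _ _ R mu k mk k0.
move=> /(measurableT_comp (@fine_measurable R setT measurableT)).
apply: eq_measurable_fun => p _ /=; rewrite /distr_fun /fubini_F Rintegral_mkcond.
rewrite /Rintegral; congr fine; apply: eq_integral => y _.
rewrite /k/= patchE indicE; have [yp|yp] := boolP (y \in _).
  by rewrite mem_set ?mulr1//; move: yp; rewrite inE/= in_itv.
rewrite memNset ?mulr0//; move/negP: yp => yp ?; apply: yp.
by rewrite inE/= in_itv.
Qed.

(* the relative growth rate of the density where F = v *)
Let vel (v : R) : R := 2 * sin (pi * v) ^+ 2 - 1.

Let vel_le1 v : `|vel v| <= 1.
Proof.
by rewrite /vel ler_norml; have := cos2Dsin2 (pi * v);
  have := sqr_ge0 (sin (pi * v)); have := sqr_ge0 (cos (pi * v)); lra.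
Qed.

Let continuous_vel : continuous vel.
Proof.
move=> v; apply: cvgB; last exact: cvg_cst.
apply: cvgM; first exact: cvg_cst.
have cs : (fun u => sin (pi * u)) @ v --> sin (pi * v).
  apply: continuous_comp; last exact: continuous_sin.
  by apply: cvgM; [exact: cvg_cst|exact: cvg_id].
exact: (cvgM cs cs).
Qed.

Let is_derive_vel v :
  is_derive v (1 : R) (fun v => - sin (2 * pi * v) / (2 * pi)) (vel v).
Proof.
have pi0 : pi != 0 :> R by rewrite gt_eqF// pi_gt0.
apply: is_derive_eq; rewrite cos_2pi /GRing.scale/= /vel.
move: (sin (2 * pi * v)) (sin (pi * v)) => s2 s.
by move: (pi : R) pi0 => p pn0; field.
Qed.

Let flow_cdf_ray s x : 0 <= s ->
  \int[mu]_(y in `]-oo, x]) (vel (distr_fun (f s) y) * f s y)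
  = - sin (2 * pi * distr_fun (f s) x) / (2 * pi).
Proof.
move=> s0; have [_ fs0 _] := df s0.
rewrite (Rintegral_distr_fun_chain fs0 (is_density_integrable (df s0)) _ is_derive_vel)//.
by rewrite mulr0 sin0 oppr0 mul0r subr0.
Qed.

(** Integrate the mild equation over ]-oo, x] and exchange the integrals in
    space and time. At each time the chain rule [Rintegral_distr_fun_chain],
    with the primitive - sin (2 pi v) / (2 pi) of 2 sin^2 (pi v) - 1, then
    evaluates the space integral. *)
Lemma distr_fun_integral_eq x t : 0 <= t ->
  distr_fun (f t) x = distr_fun f0 x
    + \int[mu]_(s in `[0, t]) (- sin (2 * pi * distr_fun (f s) x) / (2 * pi)).
Proof.
move=> t0.
pose T := `[0, t]%classic : set R; pose X := `]-oo, x]%classic : set R.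
have mT : measurable T by exact: measurable_itv.
have mX : measurable X by exact: measurable_itv.
pose g p : R := vel (distr_fun (fun y => ff (p.1, y)) p.2) * ff p.
have mg : measurable_fun setT g.
  apply: measurable_funM => //; apply: (measurableT_comp _ measurable_distr_fun2).
  exact: continuous_measurable_fun.
have gE s y : 0 <= s -> g (s, y) = vel (distr_fun (f s) y) * f s y.
  move=> s0; have ffs : (fun z => ff (s, z)) = f s.
    by apply/funext => z; exact: (ffE z s0).
  by rewrite /g/= (ffE y s0) ffs.
(* the integrand of the double integral over [0, t] x ]-oo, x] *)
pose k p : \bar R := (\1_T p.1 * (\1_X p.2 * g p))%:E.
have mk : measurable_fun setT k.
  apply/measurable_EFinP; apply: measurable_funM.
    by apply: (measurableT_comp _ measurable_fst); exact: measurable_indic.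
  apply: measurable_funM => //.
  by apply: (measurableT_comp _ measurable_snd); exact: measurable_indic.
(* the slice at time s has L^1 norm at most the mass of f_s, as [vel] is bounded by 1 *)
have ik : (mu \x mu)%E.-integrable setT k.
  apply: (@integrable12ltyP _ _ _ _ R mu mu k mk).2.
  have mak : measurable_fun setT (abse \o k) by exact: measurableT_comp mk.
  apply: (@le_lt_trans _ _ (\int[mu]_s (\1_T s)%:E)%E); last first.
    rewrite integral_indic// setIT/= lebesgue_measure_itv/=.
    by case: ifP => _; rewrite ?ltry// -EFinB ltry.
  apply: ge0_le_integral => //.
  - by move=> s _; exact: integral_ge0.
  - apply: (@measurable_fun_fubini_tonelli_F _ _ _ _ R mu _ mak) => p.
    exact: abse_ge0.
  - by apply/measurable_EFinP; exact: measurable_indic.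
  move=> s _; rewrite indicE; have [sT|sT] := boolP (s \in T); last first.
    by rewrite integral0_eq// => y _; rewrite /k/= indicE (negbTE sT) mul0r normr0.
  have s0 : 0 <= s by move: sT; rewrite inE /T/= in_itv/= => /andP[].
  have [mfs fs0 <-] := df s0; apply: ge0_le_integral => //.
  - exact: (measurableT_comp mak (pair1_measurable s)).
  - exact/measurable_EFinP.
  move=> y _; rewrite /k/= lee_fin indicE sT mul1r gE//.
  rewrite !normrM (ger0_norm (fs0 y)) ger0_norm; last by rewrite indicE.
  by rewrite mulrA ler_piMl// mulr_ile1.
pose h s : R := - sin (2 * pi * distr_fun (f s) x) / (2 * pi).
have FE : fubini_F mu k = (EFin \o h) \_ T.
  apply/funext => s; rewrite patchE /fubini_F; case: ifPn => sT; last first.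
    by apply: integral0_eq => y _; rewrite /k/= indicE (negbTE sT) mul0r.
  have s0 : 0 <= s by move: sT; rewrite inE /T/= in_itv/= => /andP[].
  rewrite /= /h -flow_cdf_ray//.
  have [mfs fs0 _] := df s0.
  have ivf : mu.-integrable setT
      (fun y => (vel (distr_fun (f s) y) * f s y)%:E).
    apply: (@integrable_bounded_mul R _ _ 1 _ _ (is_density_integrable (df s0))).
      apply: (measurableT_comp (continuous_measurable_fun continuous_vel)).
      exact: measurable_distr_fun (is_density_integrable (df s0)).
    by move=> y; exact: vel_le1.
  rewrite /Rintegral fineK; last first.
    by apply: integrable_fin_num => //; exact: integrableS ivf.
  rewrite [RHS]integral_mkcond; apply: eq_integral => y _.
  rewrite patchE /k/= !indicE sT mul1r gE//.
  by case: ifPn => yX; rewrite ?mul1r ?mul0r.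
have LE : (\int[mu]_s \int[mu]_y k (s, y) = (\int[mu]_(s in T) h s)%R%:E)%E.
  have iF := integrable_fubini_F ik.
  rewrite -[LHS]/(\int[mu]_s fubini_F mu k s)%E FE -integral_mkcond.
  rewrite /Rintegral fineK//; apply: integrable_fin_num => //.
  by apply/integrable_mkcond => //; rewrite -FE.
have idf : mu.-integrable X (EFin \o (fun y => f t y - f0 y)).
  rewrite (_ : _ \o _ = (EFin \o f t) \- (EFin \o f0))%E; last first.
    by apply/funext => y /=; rewrite EFinB.
  apply: integrableB => //.
    by apply: integrableS (is_density_integrable (df t0)).
  by apply: integrableS (is_density_integrable df0).
have RE : (\int[mu]_y \int[mu]_s k (s, y) = (\int[mu]_(y in X) (f t y - f0 y))%R%:E)%E.
  rewrite /Rintegral fineK; last exact: integrable_fin_num.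
  rewrite [RHS]integral_mkcond.
  apply: ae_eq_integral => //.
  - exact: measurable_fubini_G ik.
  - exact: (measurable_int mu
      ((@integrable_mkcond _ (measurableTypeR R) R mu X _ mX).1 idf)).
  case: mildf => _ _ _ /(_ _ t0) mild_t.
  apply: (@filterS2 _ _ (ae_filter_ringOfSetsType mu) _ _ _ _ mild_t
    (ae_integrable2 ik)) => y fty iky _.
  rewrite patchE; case: ifPn => yX; last first.
    by apply: integral0_eq => s _; rewrite /k/= [\1_X _]indicE (negbTE yX) mul0r mulr0.
  rewrite /= fty addrAC subrr add0r /Rintegral.
  have kE : (fun s => k (s, y)) =
      (fun s => (rho (f s) y - f s y)%:E) \_ T.
    apply/funext => s; rewrite patchE /k/= !indicE yX mul1r.
    case: ifPn => sT; rewrite ?mul0r// mul1r gE; last first.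
      by move: sT; rewrite inE /T/= in_itv/= => /andP[].
    by rewrite /vel /rho mulrBl mul1r.
  rewrite integral_mkcond -kE fineK//.
  exact: integrable_fin_num.
have := Fubini ik; rewrite LE RE => -[] hE.
rewrite hE RintegralB//; first by rewrite addrC subrK.
  by apply: integrableS (is_density_integrable (df t0)).
by apply: integrableS (is_density_integrable df0).
Qed.

End mild_solution.

(** * The scalar equation y' = - sin (2 pi y) / (2 pi) *)
Section angle_ode.
Context {R : realType}.
Local Notation mu := (@lebesgue_measure R).
Variable y : R -> R.
Hypothesis yE : forall t : R, 0 <= t ->
  y t = y 0 + \int[mu]_(s in `[0, t]) (- sin (2 * pi * y s) / (2 * pi)).
Hypothesis cy : forall t : R, 0 <= t ->
  y s @[s --> within [set s | 0 <= s] (nbhs t)] --> y t.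

(* freezing y at negative times makes it continuous on the whole line *)
Let z (t : R) : R := y (Num.max 0 t).
Let h (t : R) : R := - sin (2 * pi * z t) / (2 * pi).
Let pi0 : pi != 0 :> R. Proof. by rewrite gt_eqF// pi_gt0. Qed.

Let cz : continuous z.
Proof.
move=> t; apply/cvgrPdist_lt => e e0.
have m0 : 0 <= Num.max 0 t by rewrite le_max lexx.
have /cvgrPdist_lt/(_ _ e0) := cy m0.
rewrite near_withinE => yz.
have cm : Num.max 0 s @[s --> t] --> Num.max 0 t.
  by apply: (@continuous_max R R (cst 0) idfun t);
    [exact: cvg_cst|exact: cvg_id].
apply: (@filterS _ (nbhs t) _ _ _ _ (cm _ yz)) => s /=; apply.
by rewrite le_max lexx.
Qed.

Let ch : continuous h.
Proof.
move=> t; apply: cvgM; last exact: cvg_cst.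
apply: cvgN; apply: continuous_comp; last exact: continuous_sin.
by apply: cvgM; [exact: cvg_cst|exact: cz].
Qed.

Let zE t : z t = y 0 + \int[mu]_(s in `[0, t]) h s.
Proof.
rewrite /z; have [t0|t0] := leP 0 t.
  rewrite yE//; congr (_ + _); apply: eq_Rintegral => s.
  by rewrite inE/= in_itv/= => /andP[s0 _]; rewrite /h /z max_r.
by rewrite set_itv_ge ?Rintegral_set0 ?addr0// bnd_simp -ltNge.
Qed.

Let dz (t : R) : 0 < t -> is_derive t (1 : R) z (h t).
Proof.
move=> t0; have -> : z = (fun t => y 0 + \int[mu]_(s in `[0, t]) h s).
  by apply/funext => s; exact: zE.
have [] := @continuous_FTC1_closed R h 0 t (t + 1) _ _ t0 (@ch t).
- by rewrite ltrDl.
- apply: continuous_compact_integrable; first exact: segment_compact.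
  exact: continuous_subspaceT.
move=> dI Ih; rewrite -[h t]add0r; apply: is_deriveD.
by split; [exact: dI|rewrite -derive1E].
Qed.

(* W = 0 is the law tan (pi y t) = e^-t tan (pi y 0), cleared of denominators *)
Let W (t : R) : R := sin (pi * z t) * cos (pi * y 0)
  - expR (- t) * cos (pi * z t) * sin (pi * y 0).

Let dW (t : R) : 0 < t -> is_derive t (1 : R) W (- cos (pi * z t) ^+ 2 * W t).
Proof.
move=> t0; have dzt := dz t0.
apply: is_derive_eq; rewrite /W /h (sin_2pi (z t)).
rewrite /GRing.scale/=.
have := cos2Dsin2 (pi * z t).
move: (sin (pi * z t)) (cos (pi * z t)) (sin (pi * y 0)) (cos (pi * y 0)) (expR (- t)).
move: (pi : R) pi0 => p pn0 s c s0 c0 e; move=> cs.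
transitivity (- c ^+ 2 * s * c0 + s0 * e * c * (1 - s ^+ 2)); first by field.
by rewrite -cs; ring.
Qed.

Let cW : continuous W.
Proof.
move=> t; have cpz : (fun t => pi * z t) @ t --> pi * z t.
  by apply: cvgM; [exact: cvg_cst|exact: cz].
apply: cvgB; (apply: cvgM; last exact: cvg_cst).
  by apply: continuous_comp; [exact: cpz|exact: continuous_sin].
apply: cvgM; last by apply: continuous_comp; [exact: cpz|exact: continuous_cos].
by apply: continuous_comp; [apply: cvgN; exact: cvg_id|exact: continuous_expR].
Qed.

Let W0 t : 0 <= t -> W t = 0.
Proof.
rewrite le_eqVlt => /predU1P[<-|t0].
  by rewrite /W oppr0 expR0 /z max_l// mul1r mulrC subrr.
have dQ (s : R) : 0 < s -> is_derive s (1 : R) (fun s => W s ^+ 2)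
    (- (2 * cos (pi * z s) ^+ 2) * W s ^+ 2).
  move=> s0; have dWs := dW s0; apply: is_derive_eq.
  by rewrite /GRing.scale/=; ring.
have Q0 : W 0 ^+ 2 = 0.
  by rewrite /W oppr0 expR0 /z max_l// mul1r mulrC subrr expr0n.
have : W t ^+ 2 <= W 0 ^+ 2.
  apply: (@ler0_derive1_nincr R (fun s => W s ^+ 2) 0 t).
  - by move=> s; rewrite in_itv/= => /andP[s0 _]; have [] := dQ _ s0.
  - move=> s; rewrite in_itv/= => /andP[s0 _]; rewrite derive1E.
    have dQs := dQ _ s0; rewrite derive_val mulNr oppr_le0.
    by rewrite mulr_ge0 ?sqr_ge0// mulr_ge0 ?sqr_ge0.
  - by apply: continuous_subspaceT => s; apply: (cvgM (@cW s) (@cW s)).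
  - exact: lexx.
  - exact: ltW.
  - exact: lexx.
rewrite Q0 => W2; have : W t ^+ 2 = 0 by apply/le_anti; rewrite W2 sqr_ge0.
by move/eqP; rewrite sqrf_eq0 => /eqP.
Qed.

(** W' = - cos^2 (pi y) W, so W^2 is nonincreasing on [0, +oo[, and it vanishes
    at 0. *)
Lemma angle_ode_invariant t : 0 <= t ->
  sin (pi * y t) * cos (pi * y 0) = expR (- t) * cos (pi * y t) * sin (pi * y 0).
Proof.
by move=> t0; apply/eqP; rewrite -subr_eq0; have := W0 t0; rewrite /W /z max_r// => ->.
Qed.

(** Here [angle_ode_invariant] forces sin (pi y) = 0 at all times, so that the
    velocity of y vanishes. *)
Lemma angle_ode_stationary t : sin (pi * y 0) = 0 -> 0 <= t -> y t = y 0.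
Proof.
move=> s0 t0; rewrite yE//.
rewrite (_ : Rintegral _ _ _ = \int[mu]_(s in `[0, t]) (cst 0 s)).
  by rewrite Rintegral_cst ?mul0r ?addr0//; exact: measurable_itv.
apply: eq_Rintegral => s.
rewrite inE/= in_itv/= => /andP[s_ge0 _].
have /eqP := angle_ode_invariant s_ge0.
have /eqP := cos2Dsin2 (pi * y 0); rewrite s0 expr0n addr0 sqrf_eq1 mulr0.
rewrite mulf_eq0 => c0 /orP[/eqP sy|]; last by case/pred2P: c0 => ->; rewrite ?oppr_eq0 oner_eq0.
by rewrite sin_2pi sy mulr0 mul0r oppr0 mul0r.
Qed.

End angle_ode.

(** * The explicit flow of the scalar equation *)
Section flow_map.
Context {R : realType}.

(** The derivative of [flow_map] in u. *)
Definition flow_slope (e u : R) : R :=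
  e / (cos (pi * u) ^+ 2 + e ^+ 2 * sin (pi * u) ^+ 2).

(** The solution w of tan (pi w) = e tan (pi u) on the same branch as u. By the
    subtraction formula, tan (pi (u - w)) is the argument of [atan] below, which
    has no pole; and u - w is smaller than 1/2 in absolute value. *)
Definition flow_map (e u : R) : R :=
  u - atan ((1 - e) * sin (pi * u) * cos (pi * u)
            / (cos (pi * u) ^+ 2 + e * sin (pi * u) ^+ 2)) / pi.

Lemma flow_den_gt0 (a u : R) : 0 < a ->
  0 < cos (pi * u) ^+ 2 + a * sin (pi * u) ^+ 2.
Proof.
move=> a0; have := cos2Dsin2 (pi * u).
move: (sqr_ge0 (cos (pi * u))) (sqr_ge0 (sin (pi * u))).
move: (cos (pi * u) ^+ 2) (sin (pi * u) ^+ 2) => c s c0 s0 cs.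
have [s_eq0|sn0] := eqVneq s 0; first by rewrite s_eq0 mulr0; lra.
by rewrite ltr_wpDl// mulr_gt0// lt_neqAle eq_sym sn0.
Qed.

Lemma continuous_sin_pi : continuous (fun u : R => sin (pi * u)).
Proof.
move=> u; apply: continuous_comp; last exact: continuous_sin.
by apply: cvgM; [exact: cvg_cst|exact: cvg_id].
Qed.

Lemma continuous_cos_pi : continuous (fun u : R => cos (pi * u)).
Proof.
move=> u; apply: continuous_comp; last exact: continuous_cos.
by apply: cvgM; [exact: cvg_cst|exact: cvg_id].
Qed.

Lemma continuous_flow_den a : continuous
  (fun u : R => cos (pi * u) ^+ 2 + a * sin (pi * u) ^+ 2).
Proof.
move=> u; apply: cvgD.
  exact: (cvgM (@continuous_cos_pi u) (@continuous_cos_pi u)).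
apply: cvgM; first exact: cvg_cst.
exact: (cvgM (@continuous_sin_pi u) (@continuous_sin_pi u)).
Qed.

Variables (e : R) (e0 : 0 < e).

Lemma continuous_flow_slope : continuous (flow_slope e).
Proof.
move=> u; apply: cvgM; first exact: cvg_cst.
apply: cvgV; first by rewrite gt_eqF// flow_den_gt0// exprn_gt0.
exact: continuous_flow_den.
Qed.

Lemma flow_slope_gt0 u : 0 < flow_slope e u.
Proof. by rewrite divr_gt0// flow_den_gt0// exprn_gt0. Qed.

Lemma is_derive_flow_map (u : R) :
  is_derive u (1 : R) (flow_map e) (flow_slope e u).
Proof.
rewrite /flow_map /flow_slope.
have D0 := flow_den_gt0 u e0; have D1 := flow_den_gt0 u (exprn_gt0 2 e0).
have Dn0 := lt0r_neq0 D0.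
apply: is_derive_eq.
rewrite /GRing.scale/=.
have := cos2Dsin2 (pi * u).
move: (sin (pi * u)) (cos (pi * u)) D0 D1 Dn0 => s c D0 D1 Dn0 cs.
have : pi != 0 :> R by rewrite gt_eqF// pi_gt0.
move: (pi : R) => p pn0.
have D1n0 := lt0r_neq0 D1.
have -> : 1 + ((1 - e) * s * c / (c ^+ 2 + e * s ^+ 2)) ^+ 2
    = (c ^+ 2 + e ^+ 2 * s ^+ 2) / (c ^+ 2 + e * s ^+ 2) ^+ 2.
  transitivity ((c ^+ 2 + s ^+ 2) * (c ^+ 2 + e ^+ 2 * s ^+ 2)
      / (c ^+ 2 + e * s ^+ 2) ^+ 2); first by field.
  by rewrite cs mul1r.
rewrite invf_div mulr0 add0r.
transitivity (1 - (1 - e) * ((c ^+ 2 + s ^+ 2) * (c ^+ 2 - e * s ^+ 2))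
    / (c ^+ 2 + e ^+ 2 * s ^+ 2)).
  by field; rewrite exprMn D1n0 Dn0 pn0.
rewrite cs mul1r; transitivity (e * (c ^+ 2 + s ^+ 2) / (c ^+ 2 + e ^+ 2 * s ^+ 2)).
  by field; rewrite exprMn D1n0.
by rewrite cs mulr1.
Qed.

Lemma flow_map0 : flow_map e 0 = 0.
Proof. by rewrite /flow_map mulr0 sin0 mulr0 !mul0r atan0 mul0r subrr. Qed.

Lemma flow_map1 : flow_map e 1 = 1.
Proof. by rewrite /flow_map mulr1 sinpi mulr0 !mul0r atan0 mul0r subr0. Qed.

Lemma flow_map_homo : {homo flow_map e : u v / u <= v}.
Proof.
move=> u v uv; rewrite -subr_ge0 -lee_fin.
rewrite -(integral_derive uv is_derive_flow_map continuous_flow_slope).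
by apply: integral_ge0 => x _; rewrite lee_fin ltW// flow_slope_gt0.
Qed.

Lemma flow_map_itv u : 0 <= u <= 1 -> 0 <= flow_map e u <= 1.
Proof.
move=> /andP[u0 u1]; apply/andP; split.
  by rewrite -[leLHS]flow_map0 flow_map_homo.
by rewrite -[leRHS]flow_map1 flow_map_homo.
Qed.

(** The direction (cos, sin) at the angle pi w is that of (cos (pi u),
    e sin (pi u)); the positivity of k selects the branch. *)
Lemma flow_map_angle u : exists2 k : R, 0 < k &
  sin (pi * flow_map e u) = k * (e * sin (pi * u)) /\
  cos (pi * flow_map e u) = k * cos (pi * u).
Proof.
rewrite /flow_map; set D := cos _ ^+ 2 + _.
have D0 : 0 < D := flow_den_gt0 u e0.
set w := _ / D.
have -> : pi * (u - atan w / pi) = pi * u - atan w.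
  by rewrite mulrBr mulrCA divff ?mulr1// gt_eqF// pi_gt0.
have cw : 0 < cos (atan w) by apply: cos_gt0_pihalf; rewrite atan_gtNpi2 atan_ltpi2.
have sw : sin (atan w) = w * cos (atan w).
  by rewrite -[X in X * _](atanK w) /tan mulfVK// gt_eqF.
exists (cos (atan w) / D); first exact: divr_gt0.
rewrite sinB cosB sw; have := cos2Dsin2 (pi * u); have Dn0 := lt0r_neq0 D0.
move: (cos (atan w)) => q; move: Dn0; rewrite /w /D => Dn0 cs.
move: (sin (pi * u)) (cos (pi * u)) cs Dn0 => s c cs Dn0.
split.
- transitivity (q * s * (e * (c ^+ 2 + s ^+ 2)) / (c ^+ 2 + e * s ^+ 2)); first by field.
  by rewrite cs; field.
- transitivity (q * c * (c ^+ 2 + s ^+ 2) / (c ^+ 2 + e * s ^+ 2)); first by field.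
  by rewrite cs; field.
Qed.

(** The hypothesis and [flow_map_angle] make sin (pi (v - flow_map e u)) vanish,
    and both points lie strictly between 0 and 1. *)
Lemma flow_map_unique u v : 0 <= u <= 1 -> 0 <= v <= 1 -> 0 < sin (pi * u) ->
  sin (pi * v) * cos (pi * u) = e * cos (pi * v) * sin (pi * u) ->
  v = flow_map e u.
Proof.
move=> u01 v01 su0 uv; have [k k0 [sE cE]] := flow_map_angle u.
have /andP[w0 w1] := flow_map_itv u01; have /andP[v0 v1] := v01.
have p0 := @pi_gt0 R.
(* an endpoint would have sine zero, contradicting [su0] *)
have sv0 : sin (pi * v) != 0.
  apply/eqP => sv; have := cos2Dsin2 (pi * v); move/eqP: uv.
  rewrite sv mul0r expr0n addr0 eq_sym mulf_eq0 (gt_eqF su0) orbF mulf_eq0.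
  by rewrite (gt_eqF e0)/= => /eqP ->; rewrite expr0n => /eqP; rewrite eq_sym oner_eq0.
have sw0 : sin (pi * flow_map e u) != 0.
  by rewrite sE !mulf_neq0 ?gt_eqF.
have endpt (x : R) : 0 <= x -> x <= 1 -> sin (pi * x) != 0 -> 0 < x < 1.
  move=> x0 x1 sx; rewrite !lt_neqAle x0 x1 !andbT; apply/andP; split.
    by apply: contra sx => /eqP <-; rewrite mulr0 sin0.
  by apply: contra sx => /eqP ->; rewrite mulr1 sinpi.
have /andP[{}v0 {}v1] := endpt _ v0 v1 sv0.
have /andP[{}w0 {}w1] := endpt _ w0 w1 sw0.
have sd : sin (pi * v - pi * flow_map e u) = 0.
  by rewrite sinB sE cE mulrCA uv; ring.
move: w0 w1 sd; move: (flow_map e u) => w w0 w1 sd.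
have [vw|vw|//] := ltgtP v w.
- have : 0 < sin (pi * w - pi * v).
    by rewrite sin_gt0_pi// -mulrBr; apply/andP; split;
      [rewrite mulr_gt0//; lra|rewrite gtr_pMr//; lra].
  by rewrite -opprB sinN sd oppr0 ltxx.
- have : 0 < sin (pi * v - pi * w).
    by rewrite sin_gt0_pi// -mulrBr; apply/andP; split;
      [rewrite mulr_gt0//; lra|rewrite gtr_pMr//; lra].
  by rewrite sd ltxx.
Qed.

End flow_map.

(** * Explicit form of the mild solution *)
Section mild_solution_explicit.
Context {R : realType}.
Local Notation mu := (@lebesgue_measure R).
Variables (f0 : R -> R) (f : R -> R -> R).
Hypotheses (df0 : is_density f0) (mildf : mild_solution f0 f).

Let df t : 0 <= t -> is_density (f t).
Proof. by case: mildf => _ + _ _; exact. Qed.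

Lemma sin_pi_ge0 (u : R) : 0 <= u <= 1 -> 0 <= sin (pi * u).
Proof.
move=> /andP[u0 u1]; rewrite sin_ge0_pi// mulr_ge0 ?pi_ge0//=.
by rewrite ler_piMr// pi_ge0.
Qed.

(** The points where F_0 is 0 or 1 are treated apart: there the sines vanish and
    the invariant does not tell the two endpoints from each other. *)
Lemma mild_distr_funE x t : 0 <= t ->
  distr_fun (f t) x = flow_map (expR (- t)) (distr_fun f0 x).
Proof.
move=> t0.
have F00 : distr_fun (f 0) x = distr_fun f0 x.
  by rewrite (distr_fun_integral_eq df0 mildf)// set_itv1 Rintegral_set1 addr0.
have yE (s : R) : 0 <= s -> distr_fun (f s) x = distr_fun (f 0) x
    + \int[mu]_(s in `[0, s]) (- sin (2 * pi * distr_fun (f s) x) / (2 * pi)).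
  by move=> s0; rewrite F00; exact: distr_fun_integral_eq.
have cy (s : R) := @distr_fun_time_continuous R f0 f mildf x s.
have u01 := is_density_distr_fun_itv x df0.
have v01 := is_density_distr_fun_itv x (df t0).
have [su0|su0] := eqVneq (sin (pi * distr_fun f0 x)) 0.
  have -> : distr_fun (f t) x = distr_fun f0 x.
    by rewrite -F00; apply: (angle_ode_stationary yE cy) => //; rewrite F00.
  by rewrite /flow_map su0 mulr0 !mul0r atan0 mul0r subr0.
apply: flow_map_unique => //; first exact: expR_gt0.
  by rewrite lt_neqAle eq_sym su0 sin_pi_ge0.
by have := angle_ode_invariant yE cy t0; rewrite F00.
Qed.

(** By the chain rule both sides have the distribution function of
    [mild_distr_funE]. *)
Lemma mild_densityE t : 0 <= t ->
  {ae mu, forall x, f t x = flow_slope (expR (- t)) (distr_fun f0 x) * f0 x}.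
Proof.
move=> t0; have e0 := expR_gt0 (- t); have fi0 := is_density_integrable df0.
have [_ f00 _] := df0; have [_ ft0 _] := df t0.
have ms : measurable_fun setT (fun x => flow_slope (expR (- t)) (distr_fun f0 x)).
  apply: (measurableT_comp (continuous_measurable_fun (continuous_flow_slope e0))).
  exact: measurable_distr_fun.
apply: density_eq_ae => //.
- by move=> x; rewrite mulr_ge0// ltW// flow_slope_gt0.
- exact/is_density_integrable/df.
- apply: integrable_density_distr_fun => //.
    exact: (continuous_measurable_fun (continuous_flow_slope e0)).
  exact: (continuous_integrable01 (continuous_flow_slope e0)).
move=> x; rewrite mild_distr_funE//.
rewrite [RHS](Rintegral_distr_fun_chain f00 fi0 x
  (is_derive_flow_map e0) (continuous_flow_slope e0)).
by rewrite flow_map0 subr0.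
Qed.

End mild_solution_explicit.

Section tangent_flow.
Context {R : realType}.
Variables (f0 : R -> R) (f : R -> R -> R).
Hypotheses (df0 : is_density f0) (mildf : mild_solution f0 f).

Lemma cos_pi_eq0 (u : R) : 0 <= u <= 1 -> (cos (pi * u) == 0) = (u == 1 / 2).
Proof.
move=> /andP[u0 u1]; have p0 := @pi_gt0 R.
apply/eqP/eqP => [cu|->]; last by rewrite mul1r cos_pihalf.
have : pi * u = pi / 2.
  apply: cos_inj; rewrite ?in_itv/= ?cu ?cos_pihalf//.
    by rewrite mulr_ge0 ?pi_ge0//= ler_piMr ?pi_ge0.
  by apply/andP; split; lra.
by move/(mulfI (lt0r_neq0 p0)) => ->; rewrite mul1r.
Qed.

Lemma tan_flow_map (e u : R) : 0 < e -> tan (pi * flow_map e u) = e * tan (pi * u).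
Proof.
move=> e0; have [k k0 [sE cE]] := flow_map_angle e0 u.
rewrite /tan sE cE; have [->|c0] := eqVneq (cos (pi * u)) 0.
  by rewrite mulr0 invr0 !mulr0.
have kn0 : k != 0 by rewrite gt_eqF.
move: (sin _) (cos _) c0 => s c c0; field.
by rewrite c0 kn0.
Qed.

(** The pole is at the fixed point 1/2 of the flow, and +oo is invariant under
    multiplication by e > 0. *)
Lemma etan_flow_map (e u : R) : 0 < e ->
  etan (pi * flow_map e u) = (e%:E * etan (pi * u))%E.
Proof.
move=> e0; rewrite /etan tan_flow_map//.
have [k k0 [_ ->]] := flow_map_angle e0 u.
rewrite mulf_eq0 (gt_eqF k0)/=.
by case: ifPn => // _; rewrite gt0_muley// lte_fin.
Qed.

Lemma mild_has_deriv_tan (x t : R) : 0 <= t ->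
  has_deriv_at (fun s => tan (pi * distr_fun (f s) x)) t
    (- tan (pi * distr_fun (f t) x)).
Proof.
move=> t0; pose g (s : R) := expR (- s) * tan (pi * distr_fun f0 x).
have gE s : 0 <= s -> tan (pi * distr_fun (f s) x) = g s.
  by move=> s0; rewrite (mild_distr_funE df0 mildf)// tan_flow_map// expR_gt0.
have dg : is_derive t (1 : R) g (- g t).
  by apply: is_derive_eq; rewrite /g /GRing.scale/=; ring.
rewrite (gE _ t0) /has_deriv_at.
have [dgt <-] := dg.
have : h^-1 *: (g (h *: 1 + t) - g t) @[h --> (0 : R)^'] --> 'D_1 g t by exact: dgt.
move=> cvgg; apply: cvg_trans (cvg_trans (cvg_app _ (@cvg_within _ _ _ _)) cvgg).
apply: near_eq_cvg; near=> h.
have th0 : 0 <= t + h by near: h; exact: withinT.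
by rewrite (gE _ th0) (gE _ t0) /GRing.scale/= mulr1 [h + t]addrC.
Unshelve. all: by end_near. Qed.

End tangent_flow.

(** * Rescaling at the median *)
Section median.
Context {R : realType}.
Local Notation mu := (@lebesgue_measure R).
Variables (f0 : R -> R) (m : R).
Hypotheses (dpf0 : is_density_Dplus f0) (Fm : distr_fun f0 m = 1 / 2).

Let df0 : is_density f0. Proof. by case: dpf0. Qed.
Let fi0 := is_density_integrable df0.
Let f00 x : 0 <= f0 x. Proof. by case: df0. Qed.

(** Otherwise the interval where the density lives would be on one side of m,
    and the distribution function at m would be 0 or 1. *)
Lemma median_interior : exists I : set R,
  [/\ open I, I m & forall x, I x -> 0 < f0 x /\ {for x, continuous f0}].
Proof.
case: dpf0 => _ [I [oI itvI If0 nIf0]]; exists I; split => //.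
apply: contrapT => nIm.
have [Igt|] := pselect (forall x, I x -> m < x).
  have : distr_fun f0 m = 0.
    rewrite /distr_fun (_ : Rintegral _ _ _ = \int[mu]_(x in `]-oo, m]) (cst 0 x)).
      by rewrite Rintegral_cst ?mul0r//; exact: measurable_itv.
    apply: eq_Rintegral => x; rewrite inE/= in_itv/= => xm.
    by apply: nIf0 => /Igt; rewrite ltNge xm.
  by rewrite Fm; lra.
move=> /existsNP[a /not_implyP[Ia /negP]]; rewrite -leNgt => am.
have : distr_fun f0 m = 1.
  rewrite -(is_density_mass df0) /distr_fun Rintegral_mkcond.
  apply: eq_Rintegral => x _; rewrite patchE; case: ifPn => // xm.
  apply/esym/nIf0 => Ix; apply: nIm; apply: (itvI a x) => //.
  rewrite am/= leNgt; apply: contra xm => xm.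
  by rewrite inE/= in_itv/= ltW.
by rewrite Fm; lra.
Qed.

Lemma median_density_gt0 : 0 < f0 m.
Proof. by have [I [_ Im /(_ _ Im)[]]] := median_interior. Qed.

Lemma median_density_continuous : {for m, continuous f0}.
Proof. by have [I [_ Im /(_ _ Im)[]]] := median_interior. Qed.

Lemma is_derive_distr_fun_median : is_derive m (1 : R) (distr_fun f0) (f0 m).
Proof.
have [] := @continuous_FTC1 R f0 -oo%O m (m + 1) _ _ _ median_density_continuous.
- by rewrite ltrDl.
- by apply: integrableS fi0.
- by rewrite ltNyr.
by move=> dF F'; split; [exact: dF|rewrite -derive1E].
Qed.

(** With c = cos (pi F_0(m + e y)), the quotient c / e tends to
    - pi f_0(m) y, the derivative of c at e = 0. Dividing by e the numerator and the
    denominator of the argument of [atan] in [flow_map] gives an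
    expression in c / e with a finite limit. *)
Lemma cvg_flow_map_median y :
  flow_map e (distr_fun f0 (m + e * y)) @[e --> 0^'+]
    --> 1 / 2 + atan (pi * f0 m * y) / pi.
Proof.
pose q (e : R) := distr_fun f0 (m + e * y).
have q0 : q 0 = 1 / 2 by rewrite /q mul0r addr0.
pose c (e : R) := cos (pi * q e).
have dq : is_derive (0 : R) (1 : R) q (f0 m * y).
  have dF : is_derive (m + 0 * y) (1 : R) (distr_fun f0) (f0 m).
    by rewrite mul0r addr0; exact: is_derive_distr_fun_median.
  have dm : is_derive (0 : R) (1 : R) (fun e : R => m + e * y) y.
    by apply: is_derive_eq; rewrite /GRing.scale/=; ring.
  have := @is_derive1_comp R (distr_fun f0) (fun e => m + e * y) 0 _ _ dF dm.
  exact.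
have c0 : c 0 = 0 by rewrite /c q0 mul1r cos_pihalf.
have dc : is_derive (0 : R) (1 : R) c (- (pi * f0 m * y)).
  apply: is_derive_eq; rewrite q0 mul1r sin_pihalf /GRing.scale/=; ring.
have qc : {for 0, continuous q}.
  by apply/differentiable_continuous/derivable1_diffP; have [] := dq.
have qr : q e @[e --> 0^'+] --> (1 / 2 : R).
  by rewrite -[X in _ --> X]q0; apply: cvg_at_right_filter; exact: qc.
have pqc : pi * q e @[e --> 0^'+] --> (pi / 2 : R).
  rewrite (_ : pi / 2 = pi * (1 / 2)); last by rewrite mul1r.
  by apply: cvgM; [exact: cvg_cst|exact: qr].
have sc : sin (pi * q e) @[e --> 0^'+] --> (1 : R).
  by rewrite -(@sin_pihalf R); apply: continuous_cvg => //; exact: continuous_sin.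
have cc : c e @[e --> 0^'+] --> (0 : R).
  by rewrite -[X in _ --> X](@cos_pihalf R); apply: continuous_cvg => //; exact: continuous_cos.
have right_dnbhs : (0 : R)^'+ `=>` (0 : R)^'.
  move=> A; rewrite /at_right /dnbhs /within/= => -[r r0 rA]; exists r => // x xr x0.
  by apply: rA => //; rewrite gt_eqF.
have cec : c e / e @[e --> 0^'+] --> - (pi * f0 m * y).
  have [dgt <-] := dc.
  have cvgc : h^-1 *: (c (h *: 1 + 0) - c 0) @[h --> (0 : R)^'] --> 'D_1 c 0 by exact: dgt.
  apply: cvg_trans (cvg_trans (cvg_app _ right_dnbhs) cvgc).
  apply: near_eq_cvg; apply: nearW => e.
  by rewrite /GRing.scale/= mulr1 addr0 c0 subr0 mulrC.
have ec : e @[e --> (0 : R)^'+] --> (0 : R) by exact: cvg_at_right_filter.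
rewrite (_ : 1 / 2 + _ = 1 / 2 - atan ((1 - 0) * 1 * (- (pi * f0 m * y))
    / (- (pi * f0 m * y) * 0 + 1 * 1)) / pi); last first.
  by rewrite subr0 !mul1r mulr0 add0r invr1 mulr1 atanN mulNr opprK.
apply: cvg_trans; last first.
  apply: (@cvgB _ _ _ (0 : R)^'+ _ q (fun e => atan ((1 - e) * sin (pi * q e) * (c e / e)
    / (c e / e * c e + sin (pi * q e) * sin (pi * q e))) / pi)).
    exact: qr.
  apply: cvgM; last exact: cvg_cst.
  apply: continuous_cvg; first exact: continuous_atan.
  apply: cvgM.
    apply: cvgM => //; apply: cvgM => //.
    by apply: cvgB => //; exact: cvg_cst.
  apply: cvgV; first by rewrite mulr0 add0r mul1r oner_eq0.
  by apply: cvgD; exact: cvgM.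
apply: near_eq_cvg; near=> e.
have e0 : 0 < e by near: e; exact: nbhs_right_gt.
rewrite /flow_map -/(q e) -/(c e) /=; congr (_ - atan _ / _).
have := flow_den_gt0 (q e) e0; rewrite -/(c e).
move: (sin _) (c e) => s k /lt0r_neq0 D0; have en0 := lt0r_neq0 e0.
have -> : k / e * k + s * s = (k ^+ 2 + e * s ^+ 2) / e by field.
by rewrite invf_div; field; rewrite D0 en0.
Unshelve. all: by end_near. Qed.

End median.

(** * Cauchy laws *)
Section cauchy.
Context {R : realType}.
Local Notation mu := (@lebesgue_measure R).
Variables (g : R) (g0 : 0 < g).

Definition cauchy_cdf (x : R) : R := 1 / 2 + atan (x / g) / pi.

Let gn0 : g != 0. Proof. exact: lt0r_neq0. Qed.

Let den_gt0 (x : R) : 0 < (x - 0) ^+ 2 + g ^+ 2.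
Proof. by rewrite ltr_wpDl ?sqr_ge0// exprn_gt0. Qed.

Lemma cauchy_density_ge0 x : 0 <= cauchy_density 0 g x.
Proof. by rewrite /cauchy_density divr_ge0 ?mulr_ge0 ?pi_ge0 ?ltW. Qed.

Lemma continuous_cauchy_density : continuous (cauchy_density 0 g).
Proof.
move=> x; apply: cvgM; first exact: cvg_cst.
apply: cvgV; first by rewrite mulf_neq0 ?gt_eqF ?pi_gt0.
apply: cvgM; first exact: cvg_cst.
apply: cvgD; last exact: cvg_cst.
have xc : (fun y : R => y - 0) @ x --> x - 0.
  by apply: cvgB; [exact: cvg_id|exact: cvg_cst].
exact: (cvgM xc xc).
Qed.

Lemma is_derive_cauchy_cdf (x : R) :
  is_derive x (1 : R) cauchy_cdf (cauchy_density 0 g x).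
Proof.
rewrite /cauchy_cdf; apply: is_derive_eq.
rewrite /GRing.scale/= /cauchy_density subr0.
have := den_gt0 x; rewrite subr0 => /lt0r_neq0 Dn0.
have : pi != 0 :> R by rewrite gt_eqF// pi_gt0.
move: (pi : R) => p pn0.
have -> : 1 + (x / g) ^+ 2 = (x ^+ 2 + g ^+ 2) / g ^+ 2 by field.
by rewrite invf_div; field; rewrite Dn0 pn0 gn0.
Qed.

Lemma cauchy_cdf_cvgy : cauchy_cdf x @[x --> +oo%R] --> (1 : R).
Proof.
have -> : 1 = 1 / 2 + (pi / 2) / pi :> R.
  by rewrite mulrAC divff ?gt_eqF ?pi_gt0// -splitr.
apply: cvgD; first exact: cvg_cst.
apply: cvgM; last exact: cvg_cst.
apply: (cvg_comp (fun x => x / g) (@atan R)); last exact: cvgy_atan.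
by apply: gt0_cvgMly; [rewrite invr_gt0|exact: cvg_id].
Qed.

Let cauchy_upper y :
  (\int[mu]_(x in `[y, +oo[) (cauchy_density 0 g x)%:E = (1 - cauchy_cdf y)%:E)%E.
Proof.
rewrite (@ge0_continuous_FTC2y R _ cauchy_cdf y 1) ?EFinB//.
- by move=> x _; exact: cauchy_density_ge0.
- exact/continuous_subspaceT/continuous_cauchy_density.
- exact: cauchy_cdf_cvgy.
- apply: cvg_at_right_filter; apply/differentiable_continuous/derivable1_diffP.
  by have [] := is_derive_cauchy_cdf y.
- by move=> x _; have dc := is_derive_cauchy_cdf x; rewrite derive1E derive_val.
Qed.

Let cauchy_lower y :
  (\int[mu]_(x in `]-oo, y]) (cauchy_density 0 g x)%:E = (cauchy_cdf y)%:E)%E.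
Proof.
rewrite -[y]opprK ge0_integration_by_substitutionNy; last 2 first.
- exact/continuous_subspaceT/continuous_cauchy_density.
- by move=> x _; exact: cauchy_density_ge0.
transitivity (\int[mu]_(x in `[(- y)%R, +oo[) (cauchy_density 0 g x)%:E)%E.
  by apply: eq_integral => x _; rewrite /= /cauchy_density !subr0 sqrrN.
rewrite cauchy_upper; congr EFin; rewrite /cauchy_cdf opprK mulNr atanN; lra.
Qed.

Lemma distr_fun_cauchy y : distr_fun (cauchy_density 0 g) y = cauchy_cdf y.
Proof. by rewrite /distr_fun /Rintegral cauchy_lower. Qed.

Lemma is_density_cauchy : is_density (cauchy_density 0 g).
Proof.
split; [|exact: cauchy_density_ge0|].
  exact: continuous_measurable_fun continuous_cauchy_density.
have mE (A : set R) : measurable_fun A (EFin \o cauchy_density 0 g).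
  apply: measurable_funTS; apply/measurable_EFinP.
  exact: continuous_measurable_fun continuous_cauchy_density.
rewrite -(itv_setU_setT false (0 : R)) ge0_integral_setU//=.
- rewrite cauchy_lower integral_itv_obnd_cbnd// cauchy_upper -EFinD.
  by rewrite addrC subrK.
- exact: mE.
- by move=> x _; rewrite lee_fin cauchy_density_ge0.
- exact: disjoint_rays.
Qed.

End cauchy.

(** * Convergence in distribution of the rescaled solution *)
Section cvg_in_distribution.
Context {R : realType}.
Variables (f0 : R -> R) (f : R -> R -> R) (m : R).
Hypotheses (dpf0 : is_density_Dplus f0) (Fm : distr_fun f0 m = 1 / 2).
Hypothesis mildf : mild_solution f0 f.

Let df0 : is_density f0. Proof. by case: dpf0. Qed.
Let df t : 0 <= t -> is_density (f t).
Proof. by case: mildf => _ + _ _; exact. Qed.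

Lemma cvg_expRN_right : expR (- t) @[t --> +oo%R] --> (0 : R)^'+.
Proof.
move=> A [r r0 rA]; have /cvgrPdist_lt/(_ _ r0) := @cvgr_expR R.
by apply: filterS => t tr; apply: rA => //; exact: expR_gt0.
Qed.

Lemma mild_cvg_in_distribution (d : R -> measure_display)
    (T : forall t, measurableType (d t)) (P : forall t, probability (T t) R)
    (X : forall t, {RV (P t) >-> R}) :
  (forall t, 0 <= t -> has_density (X t) (f t)) ->
  cvg_in_distribution P (fun t w => expR t * (X t w - m))
    (distr_fun (cauchy_density 0 (1 / (pi * f0 m)))).
Proof.
move=> Xf y _; have fm0 := median_density_gt0 dpf0 Fm.
have g0 : 0 < 1 / (pi * f0 m) by rewrite divr_gt0 ?mulr_gt0 ?pi_gt0.
rewrite distr_fun_cauchy// /cauchy_cdf.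
have -> : y / (1 / (pi * f0 m)) = pi * f0 m * y by rewrite div1r invrK mulrC.
have cvgF : (flow_map (expR (- t)) (distr_fun f0 (m + expR (- t) * y)))%:E
    @[t --> +oo%R] --> (1 / 2 + atan (pi * f0 m * y) / pi)%:E.
  apply: cvg_EFin; first exact: nearW.
  exact: (cvg_comp _ _ cvg_expRN_right
    (@cvg_flow_map_median R f0 m dpf0 Fm y)).
apply: cvg_trans cvgF.
apply: near_eq_cvg; near=> t.
have t0 : 0 <= t by near: t; exact: nbhs_pinfty_ge.
rewrite /= -(mild_distr_funE df0 mildf)// (EFin_distr_fun (is_density_integrable (df t0))).
rewrite -(Xf t t0 `]-oo, (m + expR (- t) * y)]%classic) // /distribution /pushforward.
congr (P t _); apply/seteqP; split => w /=; rewrite in_itv/=.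
  by rewrite -lerBlDl expRN [_^-1 * y]mulrC ler_pdivlMr ?expR_gt0// mulrC.
by rewrite -lerBlDl expRN [_^-1 * y]mulrC ler_pdivlMr ?expR_gt0// mulrC.
Unshelve. all: by end_near. Qed.

End cvg_in_distribution.

(** * Evaluation of a log-sine integral by a Landen transformation *)
Section periodic_integrals.
Context {R : realType}.
Local Notation mu := (@lebesgue_measure R).
Variables (phi : R -> R) (cphi : continuous phi).

Let iphi a b : mu.-integrable `[a, b] (EFin \o phi).
Proof.
apply: continuous_compact_integrable; first exact: segment_compact.
exact: continuous_subspaceT.
Qed.

Lemma Rintegral_affine (a b x y : R) : 0 < a -> x <= y ->
  \int[mu]_(u in `[a * x + b, a * y + b]) phi u
  = a * \int[mu]_(u in `[x, y]) phi (a * u + b).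
Proof.
move=> a0 xy; pose F u : R := a * u + b.
have dF (u : R) : is_derive u (1 : R) F a.
  by rewrite /F; apply: is_derive_eq; rewrite /GRing.scale/=; ring.
have F'E : derive1 F = cst a by apply/funext => u; rewrite derive1E derive_val.
have cF : continuous F.
  by move=> u; apply: cvgD; [apply: cvgM; [exact: cvg_cst|exact: cvg_id]|exact: cvg_cst].
rewrite -RintegralZl//; last first.
  apply: continuous_compact_integrable; first exact: segment_compact.
  apply: continuous_subspaceT => u.
  by apply: continuous_comp; [exact: cF|exact: cphi].
rewrite /Rintegral -[a * x + b]/(F x) -[a * y + b]/(F y).
rewrite (@integration_by_substitution_increasing R F phi x y)//.
- by congr fine; apply: eq_integral => u _; rewrite F'E /= mulrC.
- by move=> u v _ _ uv; rewrite /F ltrD2r ltr_pM2l.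
- by rewrite F'E => u _; exact: cvg_cst.
- by rewrite F'E; exact: is_cvg_cst.
- by rewrite F'E; exact: is_cvg_cst.
- by apply: derivable_LRcontinuous => u; have [] := dF u.
- exact: continuous_subspaceT.
Qed.

Lemma Rintegral_itv_cat (a b c : R) : a <= b -> b <= c ->
  \int[mu]_(u in `[a, c]) phi u
  = \int[mu]_(u in `[a, b]) phi u + \int[mu]_(u in `[b, c]) phi u.
Proof.
move=> ab bc; rewrite -(@Rintegral_itv_obnd_cbnd R b); last first.
  apply: integrableS (iphi b c); [exact: measurable_itv|exact: measurable_itv|].
  by apply: subset_itvr; rewrite bnd_simp.
rewrite -(@Rintegral_itvB R phi (BLeft a) (BRight c) b)//.
by rewrite addrC subrK.
Qed.

Hypothesis phi1 : forall u, phi (u + 1) = phi u.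

Let phiS (a b : R) : a <= b ->
  \int[mu]_(u in `[a + 1, b + 1]) phi u = \int[mu]_(u in `[a, b]) phi u.
Proof.
move=> ab; have := @Rintegral_affine 1 1 a b ltr01 ab.
by rewrite !mul1r => ->; apply: eq_Rintegral => u _; rewrite mul1r phi1.
Qed.

Lemma Rintegral_periodic_shift :
  \int[mu]_(u in `[0, 1]) phi (u + 1 / 2) = \int[mu]_(u in `[0, 1]) phi u.
Proof.
have := @Rintegral_affine 1 (1 / 2) 0 1 ltr01 ler01.
rewrite !mul1r add0r => shiftE.
transitivity (\int[mu]_(u in `[0, 1]) phi (1 * u + 2^-1)).
  by apply: eq_Rintegral => u _; rewrite [1 * u]mul1r.
rewrite -shiftE (@Rintegral_itv_cat _ 1); [|lra|lra].
rewrite (@Rintegral_itv_cat 0 2^-1 1); [|lra|lra].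
rewrite addrC; congr (_ + _).
by have := @phiS 0 2^-1; rewrite add0r addrC => ->//; lra.
Qed.

Lemma Rintegral_periodic_double :
  \int[mu]_(u in `[0, 1]) phi (2 * u) = \int[mu]_(u in `[0, 1]) phi u.
Proof.
have := @Rintegral_affine 2 0 0 1 (ltr0Sn R 1) ler01.
rewrite mulr0 mulr1 !addr0 (@Rintegral_itv_cat 0 1 2); [|lra|lra].
have := @phiS 0 1 ler01; rewrite add0r => ->.
have n2 : 2 != 0 :> R by rewrite pnatr_eq0.
move=> doubleE; apply: (mulfI n2); rewrite [RHS]mulr_natl [RHS]mulr2n doubleE.
by congr (2 * _); apply: eq_Rintegral => u _; rewrite addr0.
Qed.

End periodic_integrals.

Section landen.
Context {R : realType}.
Local Notation mu := (@lebesgue_measure R).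

Definition logsin (e u : R) : R :=
  ln (sin (pi * u) ^+ 2 + e ^+ 2 * cos (pi * u) ^+ 2).

Lemma logsin_arg_gt0 (e u : R) : 0 < e ->
  0 < sin (pi * u) ^+ 2 + e ^+ 2 * cos (pi * u) ^+ 2.
Proof.
move=> e0; have := flow_den_gt0 (u + 2^-1) (exprn_gt0 2 e0).
by rewrite mulrDr sinDpihalf cosDpihalf sqrrN.
Qed.

Lemma continuous_logsin (e : R) : 0 < e -> continuous (logsin e).
Proof.
move=> e0 u; apply: continuous_comp; last exact/continuous_ln/logsin_arg_gt0.
apply: cvgD.
  exact: (cvgM (@continuous_sin_pi R u) (@continuous_sin_pi R u)).
apply: cvgM; first exact: cvg_cst.
exact: (cvgM (@continuous_cos_pi R u) (@continuous_cos_pi R u)).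
Qed.

Lemma logsin_periodic (e u : R) : logsin e (u + 1) = logsin e u.
Proof. by rewrite /logsin mulrDr mulr1 sinDpi cosDpi !sqrrN. Qed.

Lemma logsin_shift (e u : R) : logsin e (u + 1 / 2) =
  ln (cos (pi * u) ^+ 2 + e ^+ 2 * sin (pi * u) ^+ 2).
Proof. by rewrite /logsin mulrDr mul1r sinDpihalf cosDpihalf sqrrN. Qed.

(** With s and c the sine and cosine of pi u, and e' = 2 e / (1 + e^2),
    (s^2 + e^2 c^2) (c^2 + e^2 s^2) is ((1 + e^2) / 2)^2 times
    sin^2 (2 pi u) + e'^2 cos^2 (2 pi u). *)
Lemma logsin_landen (e u : R) : 0 < e ->
  logsin e u + logsin e (u + 1 / 2)
  = 2 * ln ((1 + e ^+ 2) / 2) + logsin (2 * e / (1 + e ^+ 2)) (2 * u).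
Proof.
move=> e0; have S0 : 0 < 1 + e ^+ 2 by rewrite ltr_pwDl// sqr_ge0.
have e'0 : 0 < 2 * e / (1 + e ^+ 2) by rewrite divr_gt0// mulr_gt0.
have A0 := logsin_arg_gt0 u e0.
have B0 := flow_den_gt0 u (exprn_gt0 2 e0).
have C0 := logsin_arg_gt0 (2 * u) e'0.
rewrite logsin_shift /logsin -lnM ?posrE//.
have -> : 2 * ln ((1 + e ^+ 2) / 2) = ln (((1 + e ^+ 2) / 2) ^+ 2).
  by rewrite lnXn ?divr_gt0// mulr_natl.
rewrite -lnM ?posrE ?exprn_gt0 ?divr_gt0//; congr ln.
have -> : pi * (2 * u) = 2 * pi * u by rewrite mulrCA mulrA.
rewrite sin_2pi cos_2pi.
have := cos2Dsin2 (pi * u); have Sn0 := lt0r_neq0 S0.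
move: (sin (pi * u)) (cos (pi * u)) => s c cs.
have -> : 1 - 2 * s ^+ 2 = c ^+ 2 - s ^+ 2 by lra.
transitivity (e ^+ 2 * (c ^+ 2 + s ^+ 2) ^+ 2 + (1 - e ^+ 2) ^+ 2 * s ^+ 2 * c ^+ 2).
  by ring.
rewrite [LHS](_ : _ = (1 + e ^+ 2) ^+ 2 * s ^+ 2 * c ^+ 2
  + e ^+ 2 * (c ^+ 2 - s ^+ 2) ^+ 2); last by ring.
by field.
Qed.

Definition logsin_int (e : R) : R := \int[mu]_(u in `[0, 1]) logsin e u.

(** Neither the half-period shift nor the doubling of the argument changes the
    integral over a period. *)
Lemma logsin_int_landen (e : R) : 0 < e ->
  2 * logsin_int e = 2 * ln ((1 + e ^+ 2) / 2) + logsin_int (2 * e / (1 + e ^+ 2)).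
Proof.
move=> e0; have S0 : 0 < 1 + e ^+ 2 by rewrite ltr_pwDl// sqr_ge0.
have e'0 : 0 < 2 * e / (1 + e ^+ 2) by rewrite divr_gt0// mulr_gt0.
have cont2 (phi : R -> R) a b : continuous phi -> mu.-integrable `[a, b] (EFin \o phi).
  move=> cphi; apply: continuous_compact_integrable; first exact: segment_compact.
  exact: continuous_subspaceT.
have cl := continuous_logsin e0; have cl' := continuous_logsin e'0.
rewrite mulr_natl mulr2n /logsin_int.
rewrite -[X in _ + X](Rintegral_periodic_shift cl (logsin_periodic e)).
rewrite -(Rintegral_periodic_double cl' (logsin_periodic _)).
rewrite -RintegralD//=; last 2 first.
- exact: cont2.
- apply: cont2 => u; apply: continuous_comp; last exact: cl.
  by apply: cvgD; [exact: cvg_id|exact: cvg_cst].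
under eq_Rintegral do rewrite logsin_landen//.
rewrite RintegralD//=; last 2 first.
- by apply: cont2 => u; exact: cvg_cst.
- apply: cont2 => u; apply: continuous_comp; last exact: cl'.
  by apply: cvgM; [exact: cvg_cst|exact: cvg_id].
congr (_ + _); rewrite Rintegral_cst//= lebesgue_measure_itv/= lte01.
by rewrite sube0 mulr1.
Qed.

End landen.

Section log_sine_integral.
Context {R : realType}.
Local Notation mu := (@lebesgue_measure R).

Let int01_le (phi : R -> R) (c : R) : continuous phi ->
  (forall u, c <= phi u <= 0) -> c <= \int[mu]_(u in `[0, 1]) phi u <= 0.
Proof.
move=> cphi cphi0.
have iphi := continuous_integrable01 cphi.
have icst a : mu.-integrable `[0, 1] (EFin \o (fun=> a : R)).
  by apply: continuous_integrable01 => u; exact: cvg_cst.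
have cstE (a : R) : \int[mu]_(u in `[0, 1]) a = a.
  by rewrite Rintegral_cst//= lebesgue_measure_itv/= lte01 sube0 mulr1.
apply/andP; split.
- rewrite -[leLHS](cstE c); apply: le_Rintegral (icst c) iphi _ => // u _.
  by case/andP: (cphi0 u).
- rewrite -[leRHS](cstE 0); apply: le_Rintegral iphi (icst 0) _ => // u _.
  by case/andP: (cphi0 u).
Qed.

Lemma logsin_itv (d e u : R) : 0 < d -> d <= e -> e <= 1 ->
  2 * ln d <= logsin e u <= 0.
Proof.
move=> d0 de e1; have e0 : 0 < e by exact: lt_le_trans de.
have A0 := logsin_arg_gt0 u e0.
have e2 : 0 <= e ^+ 2 <= 1 by rewrite sqr_ge0 expr_le1// ltW.
have d2 : d ^+ 2 <= e ^+ 2 by rewrite ler_sqr// nnegrE ltW.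
have d2p : 0 < d ^+ 2 by rewrite exprn_gt0.
have cs := cos2Dsin2 (pi * u); have c0 := sqr_ge0 (cos (pi * u)).
have s0 := sqr_ge0 (sin (pi * u)).
rewrite ln_le0 ?andbT; last by nra.
rewrite mulr_natl -lnXn// /logsin ler_ln ?posrE//; nra.
Qed.

Let defect (e : R) : R := logsin_int e - 2 * ln ((1 + e) / 2).

Let defect_landen (e : R) : 0 < e -> 2 * defect e = defect (2 * e / (1 + e ^+ 2)).
Proof.
move=> e0; rewrite /defect mulrBr logsin_int_landen//.
have S0 : 0 < 1 + e ^+ 2 by rewrite ltr_pwDl// sqr_ge0.
have T0 : 0 < 1 + e by lra.
have -> : (1 + 2 * e / (1 + e ^+ 2)) / 2 = ((1 + e) / 2) ^+ 2 / ((1 + e ^+ 2) / 2).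
  by have Sn0 := lt0r_neq0 S0; field.
rewrite [ln (_ ^+ 2 / _)]ln_div ?posrE ?exprn_gt0 ?divr_gt0// lnXn ?divr_gt0// mulr2n; ring.
Qed.

Let defect_bound (d e : R) : 0 < d -> d <= e -> e <= 1 ->
  `|defect e| <= 2 * ln 2 - 2 * ln d.
Proof.
move=> d0 de e1; have e0 : 0 < e by exact: lt_le_trans de.
have /andP[J1 J0] : 2 * ln d <= logsin_int e <= 0.
  by apply: int01_le; [exact: continuous_logsin|move=> u; exact: logsin_itv].
have l0 : ln ((1 + e) / 2) <= 0 by apply: ln_le0; lra.
have l1 : - ln 2 <= ln ((1 + e) / 2).
  by rewrite -lnV ?posrE// ler_ln ?posrE ?divr_gt0//; lra.
by rewrite ler_norml /defect; apply/andP; split; lra.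
Qed.

(** The closed form satisfies the functional equation of [logsin_int_landen] too.
    The difference of both sides therefore satisfies 2 defect(e) = defect(e'),
    where e' = 2 e / (1 + e^2) lies in [e, 1]. As it is bounded on [e, 1],
    iterating gives |defect(e)| <= C / 2^n for all n. *)
Lemma logsin_intE (e : R) : 0 < e -> e <= 1 -> logsin_int e = 2 * ln ((1 + e) / 2).
Proof.
move=> e0 e1.
have geo n : forall x, e <= x -> x <= 1 ->
    `|defect x| <= (2 * ln 2 - 2 * ln e) / 2 ^+ n.
  elim: n => [|n IHn] x ex x1; first by rewrite expr0 divr1; exact: defect_bound.
  have x0 : 0 < x by exact: lt_le_trans ex.
  have S0 : 0 < 1 + x ^+ 2 by rewrite ltr_pwDl// sqr_ge0.
  have x2 : x ^+ 2 <= 1 by rewrite expr_le1// ltW.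
  have ex' : e <= 2 * x / (1 + x ^+ 2) by rewrite ler_pdivlMr//; nra.
  have x'1 : 2 * x / (1 + x ^+ 2) <= 1.
    by rewrite ler_pdivrMr// mul1r; have := sqr_ge0 (1 - x); nra.
  have := IHn _ ex' x'1.
  rewrite -defect_landen// normrM ger0_norm// [2 ^+ n.+1]exprS invfM mulrCA.
  by rewrite ler_pdivlMl.
set C := 2 * ln 2 - 2 * ln e in geo.
have C0 : 0 <= C by apply: le_trans (defect_bound e0 (lexx e) e1).
suff : `|defect e| <= 0 by rewrite normr_le0 subr_eq0 => /eqP.
apply/ler_addgt0Pr => r r0; rewrite add0r.
have [n nC] : exists n, C / r < 2 ^+ n.
  exists (Num.bound (C / r)); apply: (lt_le_trans (archi_boundP _)).
    by rewrite divr_ge0// ltW.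
  by rewrite -natrX ler_nat ltnW// ltn_expl.
apply: le_trans (geo n e (lexx e) e1) _.
by rewrite ler_pdivrMr ?exprn_gt0// mulrC -ler_pdivrMr// ltW.
Qed.

Lemma measurable_logsin (e : R) : measurable_fun setT (logsin e).
Proof.
apply: (@measurableT_comp _ _ _ _ _ _ (@ln R) setT
  (fun u : R => sin (pi * u) ^+ 2 + e ^+ 2 * cos (pi * u) ^+ 2)) => //.
apply: continuous_measurable_fun => u; apply: cvgD.
  exact: (cvgM (@continuous_sin_pi R u) (@continuous_sin_pi R u)).
apply: cvgM; first exact: cvg_cst.
exact: (cvgM (@continuous_cos_pi R u) (@continuous_cos_pi R u)).
Qed.

(** Monotone convergence along e = 1 / (n + 1). The endpoints 0 and 1 are
    removed first, because [ln 0] is 0 by convention and the integrands do not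
    converge to it there. *)
Lemma integral_logsin0 :
  (\int[mu]_(u in `[0%R, 1%R]) (- logsin 0 u)%:E = (2 * ln 2)%:E)%E.
Proof.
pose e n : R := n.+1%:R^-1.
have e0 n : 0 < e n by rewrite invr_gt0.
have e1 n : e n <= 1 by rewrite invf_le1// ler1n.
have ecvg : e n @[n --> \oo] --> (0 : R) by exact: cvg_harmonic.
have mN a D : measurable_fun D (fun u : R => (- logsin a u)%:E).
  apply: measurable_funTS; apply/measurable_EFinP; apply: measurableT_comp => //.
  exact: measurable_logsin.
rewrite integral_itv_bndoo; last exact: mN.
have intE n : (\int[mu]_(u in `]0%R, 1%R[) (- logsin (e n) u)%:E
    = (- (2 * ln ((1 + e n) / 2)))%:E)%E.
  rewrite -(@integral_itv_bndoo _ 0 1 _ true false); last exact: mN.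
  have il := continuous_integrable01 (continuous_logsin (e0 n)).
  rewrite -logsin_intE// /logsin_int /Rintegral EFinN fineK ?integrable_fin_num//.
  rewrite -integralN; last by apply: integrable_add_def il.
  by apply: eq_integral => u _; rewrite EFinN.
transitivity (\int[mu]_(u in `]0%R, 1%R[) (limn (fun n => (- logsin (e n) u)%:E)))%E.
  apply: eq_integral => u; rewrite inE/= in_itv/= => /andP[u0 u1].
  apply/esym/cvg_lim => //; apply: cvg_EFin; first exact: nearW.
  apply: cvgN; rewrite /logsin; apply: continuous_cvg.
    apply: continuous_ln; rewrite expr0n mul0r addr0 exprn_gt0//.
    rewrite sin_gt0_pi// mulr_gt0 ?pi_gt0//=.
    by rewrite -[ltRHS]mulr1 ltr_pM2l// pi_gt0.
  apply: cvgD; first exact: cvg_cst.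
  apply: cvgM; last exact: cvg_cst.
  rewrite expr2; under eq_fun do rewrite expr2.
  exact: cvgM.
rewrite monotone_convergence//=; last 3 first.
- by move=> n; exact: mN.
- move=> n u _; rewrite lee_fin oppr_ge0.
  by have /andP[] := logsin_itv u (e0 n) (lexx _) (e1 n).
- move=> u _ n k nk; rewrite lee_fin lerN2 ler_ln ?posrE ?logsin_arg_gt0//.
  rewrite lerD2l ler_wpM2r ?sqr_ge0// ler_sqr ?nnegrE ?(ltW (e0 _))//.
  by rewrite lef_pV2 ?posrE// ler_nat.
apply/cvg_lim => //.
under eq_fun do rewrite intE.
have -> : 2 * ln 2 = - (2 * ln ((1 + 0) / 2)) :> R.
  by rewrite addr0 div1r lnV ?posrE// mulrN opprK.
apply: cvg_EFin; first exact: nearW.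
apply: cvgN; apply: cvgM; first exact: cvg_cst.
apply: continuous_cvg; first by apply: continuous_ln; rewrite addr0.
apply: cvgM; last exact: cvg_cst.
by apply: cvgD; [exact: cvg_cst|exact: ecvg].
Qed.

Lemma integrable_logsin0 : mu.-integrable `[0, 1] (EFin \o logsin 0).
Proof.
apply/integrableP; split.
  by apply: measurable_funTS; apply/measurable_EFinP; exact: measurable_logsin.
have logsin0_le0 (u : R) : logsin 0 u <= 0.
  rewrite /logsin expr0n mul0r addr0; apply: ln_le0.
  by have := cos2Dsin2 (pi * u); have := sqr_ge0 (cos (pi * u)); lra.
under eq_integral do rewrite /= ler0_norm//.
by rewrite integral_logsin0 ltry.
Qed.

Lemma Rintegral_logsin0 : \int[mu]_(u in `[0, 1]) logsin 0 u = - (2 * ln 2).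
Proof.
have := integral_logsin0.
under eq_integral do rewrite EFinN.
rewrite integralN; last by apply: integrable_add_def integrable_logsin0.
by rewrite /Rintegral => /eqP; rewrite eqe_oppLR => /eqP ->.
Qed.

End log_sine_integral.

(** * Concentration of densities at a point *)
Section concentration.
Context {R : realType}.
Local Notation mu := (@lebesgue_measure R).

Let integrable_scale (c : R) (h : R -> R) : mu.-integrable setT (EFin \o h) ->
  mu.-integrable setT (EFin \o (fun x => c * h x)).
Proof.
by move=> ih; have := integrableZl measurableT c ih; exact: eq_integrable.
Qed.

(** Split the integral of |psi - psi(m)| g_i at distance d from m. Within, psi is
    close to psi(m) and g_i has mass at most 1; outside, g_i is at most r w and
    the integral at most r times that of |psi - psi(m)| w. *)
Lemma concentration (I : Type) (F : set_system I) (FF : Filter F)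
    (g : I -> R -> R) (w psi : R -> R) (m : R) :
  (\forall i \near F, is_density (g i)) ->
  (forall x, 0 <= w x) -> mu.-integrable setT (EFin \o w) ->
  mu.-integrable setT (fun x => (psi x * w x)%:E) ->
  (\forall i \near F, mu.-integrable setT (fun x => (psi x * g i x)%:E)) ->
  {for m, continuous psi} ->
  (forall d r, 0 < d -> 0 < r ->
    \forall i \near F, forall x, d <= `|x - m| -> g i x <= r * w x) ->
  \int[mu]_x (psi x * g i x) @[i --> F] --> psi m.
Proof.
move=> dg w0 iw ipw ipg cpsi off.
have ipmw : mu.-integrable setT (fun x => ((psi x - psi m) * w x)%:E).
  rewrite (_ : (fun _ => _) = (fun x => (psi x * w x)%:E) \- (fun x => (psi m)%:E * (w x)%:E))%E.
    by apply: integrableB => //; exact: integrableZl.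
  by apply/funext => x; rewrite /= mulrBl EFinB.
have ipmw' : mu.-integrable setT (fun x => (`|psi x - psi m| * w x)%:E).
  have := integrable_abse ipmw; apply: eq_integrable => // x _ /=.
  by rewrite normrM (ger0_norm (w0 x)).
set B := \int[mu]_x (`|psi x - psi m| * w x).
have B0 : 0 <= B by apply: Rintegral_ge0 => x _; rewrite mulr_ge0.
apply/cvgrPdist_le => e e0.
have /cvgrPdist_le/(_ _ (divr_gt0 e0 (ltr0Sn R 1))) [d d0 near_m] := cpsi.
have r0 : 0 < e / 2 / (B + 1) by rewrite !divr_gt0// ltr_pwDr.
near=> i.
have dgi : is_density (g i) by near: i.
have ipgi : mu.-integrable setT (fun x => (psi x * g i x)%:E) by near: i.
have offi : forall x, d <= `|x - m| -> g i x <= e / 2 / (B + 1) * w x.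
  by near: i; exact: off.
have [_ gi0 _] := dgi; have igi := is_density_integrable dgi.
have ipmg : mu.-integrable setT (fun x => ((psi x - psi m) * g i x)%:E).
  rewrite (_ : (fun _ => _) = (fun x => (psi x * g i x)%:E)
      \- (fun x => (psi m)%:E * (g i x)%:E))%E.
    by apply: integrableB => //; exact: integrableZl.
  by apply/funext => x; rewrite /= mulrBl EFinB.
have -> : psi m - \int[mu]_x (psi x * g i x) = - \int[mu]_x ((psi x - psi m) * g i x).
  have -> : \int[mu]_x ((psi x - psi m) * g i x) =
      \int[mu]_x (psi x * g i x - psi m * g i x).
    by apply: eq_Rintegral => x _; rewrite mulrBl.
  rewrite RintegralB//; last first.
    exact: integrable_scale.
  by rewrite RintegralZl// (is_density_mass dgi) mulr1 opprB.
rewrite normrN; apply: le_trans (le_normr_Rintegral _ _) _ => //.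
apply: (@le_trans _ _ (\int[mu]_x (e / 2 * g i x
    + e / 2 / (B + 1) * (`|psi x - psi m| * w x)))).
  apply: le_Rintegral => //.
  - by have := integrable_abse ipmg; exact: eq_integrable.
  - rewrite (_ : _ \o _ = (fun x => (e / 2)%:E * (g i x)%:E) \+
      (fun x => (e / 2 / (B + 1))%:E * (`|psi x - psi m| * w x)%:E))%E.
      by apply: integrableD => //; exact: integrableZl.
    by apply/funext => x; rewrite /= EFinD.
  move=> x _; rewrite normrM (ger0_norm (gi0 x)).
  have [xm|xm] := ltP `|x - m| d.
    rewrite ler_wpDr//; first by rewrite mulr_ge0 ?(ltW r0)// mulr_ge0.
    rewrite ler_wpM2r// distrC; apply: near_m => /=; by rewrite distrC.
  rewrite ler_wpDl//; first by rewrite mulr_ge0 ?divr_ge0 ?(ltW e0).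
  by rewrite mulrCA ler_wpM2l// offi.
rewrite RintegralD//; last 2 first.
- exact: integrable_scale.
- exact: integrable_scale.
rewrite !RintegralZl// (is_density_mass dgi) mulr1 -/B.
rewrite [leRHS](splitr e) lerD2l mulrAC -mulrA ler_piMr//.
  by rewrite ltW// divr_gt0.
by rewrite ler_pdivrMr ?ltr_pwDr// mul1r lerDl.
Unshelve. all: by end_near. Qed.

End concentration.

Section concentration_at_median.
Context {R : realType}.
Local Notation mu := (@lebesgue_measure R).

Lemma sin_pi_sqr_homo (u v : R) : 0 <= u -> u <= v -> v <= 1 / 2 ->
  sin (pi * u) ^+ 2 <= sin (pi * v) ^+ 2.
Proof.
move=> u0 uv v2; have p0 := @pi_gt0 R.
have cuv : cos (2 * pi * v) <= cos (2 * pi * u).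
  move: uv; rewrite le_eqVlt => /predU1P[->//|uv]; rewrite ltW// ltr_cos.
  - by rewrite ltr_pM2l// mulr_gt0.
  - by rewrite in_itv/=; apply/andP; split; nra.
  - by rewrite in_itv/=; apply/andP; split; nra.
by move: cuv; rewrite !cos_2pi; lra.
Qed.

Lemma sin_pi_sym (u : R) : sin (pi * (1 - u)) = sin (pi * u).
Proof. by rewrite mulrBr mulr1 sinB sinpi cospi mul0r sub0r mulN1r opprK. Qed.

Lemma cos_pi_sym (u : R) : cos (pi * (1 - u)) = - cos (pi * u).
Proof. by rewrite mulrBr mulr1 cosB sinpi cospi mul0r addr0 mulN1r. Qed.

Variables (f0 : R -> R) (m : R).
Hypotheses (dpf0 : is_density_Dplus f0) (Fm : distr_fun f0 m = 1 / 2).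

Let df0 : is_density f0. Proof. by case: dpf0. Qed.
Let fi0 := is_density_integrable df0.
Let f00 x : 0 <= f0 x. Proof. by case: df0. Qed.

Let near_median : exists2 d, 0 < d & forall h, h != 0 -> `|h| < d ->
  0 < h^-1 * (distr_fun f0 (m + h) - 1 / 2).
Proof.
have [dF F'] := is_derive_distr_fun_median dpf0 Fm.
have : h^-1 *: (distr_fun f0 (h *: 1 + m) - distr_fun f0 m) @[h --> (0 : R)^'] --> f0 m.
  by rewrite -F'; exact: dF.
move=> /(cvgr_gt _)/(_ _ (median_density_gt0 dpf0 Fm)) [d d0 dP]; exists d => // h h0 hd.
have := dP h; rewrite /ball/= sub0r normrN => /(_ hd h0).
by rewrite /GRing.scale/= mulr1 Fm [h + m]addrC.
Qed.

(** F_0 has the positive derivative f_0(m) at m, so it leaves the value 1/2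
    strictly, and it is monotone. *)
Lemma distr_fun_lt_median x : x < m -> distr_fun f0 x < 1 / 2.
Proof.
move=> xm; have [d d0 dP] := near_median.
pose h := Num.min (d / 2) (m - x).
have h0 : 0 < h by rewrite lt_min divr_gt0// subr_gt0.
have hd : h < d by rewrite gt_min; apply/orP; left; lra.
have := dP (- h); rewrite oppr_eq0 normrN (gtr0_norm h0) gt_eqF// => /(_ isT hd).
rewrite invrN mulNr oppr_gt0 pmulr_rlt0 ?invr_gt0// subr_lt0; apply: le_lt_trans.
apply: (distr_fun_homo f00 fi0); rewrite lerBrDl -lerBrDr.
by rewrite ge_min lexx orbT.
Qed.

Lemma distr_fun_gt_median x : m < x -> 1 / 2 < distr_fun f0 x.
Proof.
move=> mx; have [d d0 dP] := near_median.
pose h := Num.min (d / 2) (x - m).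
have h0 : 0 < h by rewrite lt_min divr_gt0// subr_gt0.
have hd : h < d by rewrite gt_min; apply/orP; left; lra.
have := dP h; rewrite (gtr0_norm h0) gt_eqF// => /(_ isT hd).
rewrite pmulr_rgt0 ?invr_gt0// subr_gt0 => /lt_le_trans; apply.
apply: (distr_fun_homo f00 fi0); rewrite -lerBrDl.
by rewrite ge_min lexx orbT.
Qed.

(** Off a neighbourhood of m the values of F_0 keep away from 1/2, within
    [0, v] or [1 - v, 1] for some v < 1/2. There the factor a_i(F_0) is at most
    a_i(v), by symmetry and monotonicity, and a_i(v) tends to 0; so
    [concentration] applies with w = f_0. *)
Lemma concentration_median (T : Type) (F : set_system T) (FF : Filter F)
    (a : T -> R -> R) (psi : R -> R) :
  (\forall i \near F, is_density (fun x => a i (distr_fun f0 x) * f0 x)) ->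
  (\forall i \near F, measurable_fun setT (a i)) ->
  (forall i u, a i (1 - u) = a i u) ->
  (\forall i \near F, forall u v, 0 <= u -> u <= v -> v <= 1 / 2 ->
    0 <= a i u <= a i v) ->
  (forall u, 0 <= u < 1 / 2 -> a i u @[i --> F] --> (0 : R)) ->
  mu.-integrable setT (fun x => (psi x * f0 x)%:E) ->
  {for m, continuous psi} ->
  \int[mu]_x (psi x * (a i (distr_fun f0 x) * f0 x)) @[i --> F] --> psi m.
Proof.
move=> da ma asym amono a0 ipsi cpsi.
have Fitv x := is_density_distr_fun_itv x df0.
have aF i : (forall u v, 0 <= u -> u <= v -> v <= 1 / 2 -> 0 <= a i u <= a i v) ->
    forall x v, 0 <= v <= 1 / 2 -> distr_fun f0 x <= v \/ 1 - v <= distr_fun f0 x ->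
    0 <= a i (distr_fun f0 x) <= a i v.
  move=> ai x v /andP[v0 v2] [] Fv; have /andP[F0 F1] := Fitv x; first exact: ai.
  by rewrite -asym; apply: ai; lra.
apply: (concentration FF da f00 fi0 ipsi _ cpsi).
  near=> i.
  have ai : forall u v, 0 <= u -> u <= v -> v <= 1 / 2 -> 0 <= a i u <= a i v.
    by near: i.
  have mai : measurable_fun setT (a i) by near: i.
  have ab x : `|a i (distr_fun f0 x)| <= a i (1 / 2).
    have [F2|F2] := leP (distr_fun f0 x) (1 / 2).
      by have /andP[? ?] : 0 <= a i (distr_fun f0 x) <= a i (1 / 2);
        [apply: aF => //; [lra|left]|rewrite ger0_norm].
    by have /andP[? ?] : 0 <= a i (distr_fun f0 x) <= a i (1 / 2);
        [apply: aF => //; [lra|right; lra]|rewrite ger0_norm].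
  have := @integrable_bounded_mul R (fun x => a i (distr_fun f0 x)) _ _ _ ab ipsi.
  have maF : measurable_fun setT (fun x => a i (distr_fun f0 x)).
    exact: (measurableT_comp mai (measurable_distr_fun f00 fi0)).
  by move=> /(_ maF); apply: eq_integrable => // x _; rewrite mulrCA.
move=> d r d0 r0.
pose v := Num.max (distr_fun f0 (m - d)) (1 - distr_fun f0 (m + d)).
have v0 : 0 <= v by rewrite le_max; have /andP[-> _] := Fitv (m - d).
have v2 : v < 1 / 2.
  rewrite gt_max distr_fun_lt_median//=; last by lra.
  by have := @distr_fun_gt_median (m + d); lra.
have /cvgrPdist_lt/(_ _ r0) av : a i v @[i --> F] --> (0 : R) by apply: a0; rewrite v0.
near=> i => x xd.
have ai : forall u v, 0 <= u -> u <= v -> v <= 1 / 2 -> 0 <= a i u <= a i v by near: i.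
rewrite ler_wpM2r//.
have avr : a i v < r.
  by apply: le_lt_trans (ler_norm _) _; rewrite -normrN -sub0r; near: i.
apply: le_trans (ltW avr).
have /andP[//] : 0 <= a i (distr_fun f0 x) <= a i v.
apply: aF => //; first by rewrite v0 ltW.
have [xm|mx] := leP x m.
  left; rewrite le_max (distr_fun_homo f00 fi0)//.
  by move: xd; rewrite ler0_norm ?subr_le0//; lra.
right; rewrite lerBlDr -lerBlDl le_max; apply/orP; right.
rewrite lerB// (distr_fun_homo f00 fi0)//.
by move: xd; rewrite gtr0_norm ?subr_gt0//; lra.
Unshelve. all: by end_near. Qed.

End concentration_at_median.

(** * The entropy of a density a(F_0) f_0 *)
Section entropy.
Context {R : realType}.
Local Notation mu := (@lebesgue_measure R).

Lemma entropy_ae (f g : R -> R) : measurable_fun setT f -> measurable_fun setT g ->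
  {ae mu, forall x, f x = g x} -> entropy f = entropy g.
Proof.
move=> mf mg fg; rewrite /entropy; congr (- _)%E; apply: ae_eq_integral => //.
- by apply/measurable_EFinP; apply: measurable_funM => //; exact: measurableT_comp mf.
- by apply/measurable_EFinP; apply: measurable_funM => //; exact: measurableT_comp mg.
by apply: (@filterS _ _ (ae_filter_ringOfSetsType mu) _ _ _ fg) => x fgx _; rewrite fgx.
Qed.

Lemma xlnx_bound (C a : R) : 0 <= a <= C -> `|a * ln a| <= 1 + C ^+ 2.
Proof.
move=> /andP[]; rewrite le_eqVlt => /predU1P[<- C0|a0 aC].
  by rewrite mul0r normr0 addr_ge0// sqr_ge0.
have aV := ln_sublinear a0; have := @ln_sublinear R a^-1; rewrite invr_gt0 => /(_ a0).
rewrite lnV ?posrE// => aV'.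
have h1 : - 1 <= a * ln a.
  by rewrite lerNl -mulrN -[leRHS](divff (lt0r_neq0 a0)) ler_pM2l// ltW.
have h2 : a * ln a <= a * a by rewrite ler_pM2l// ltW.
have h3 : a * a <= C ^+ 2 by rewrite -expr2 ler_sqr ?nnegrE ?(ltW a0)// (le_trans (ltW a0)).
by rewrite ler_norml; apply/andP; split; have := sqr_ge0 C; lra.
Qed.

Lemma log_moment_integrable (f0 : R -> R) : is_density f0 -> finite_log_moment f0 ->
  mu.-integrable setT (fun x => (ln (f0 x) * f0 x)%:E).
Proof.
move=> [mf0 f00 _] lf0; apply/integrableP; split.
  by apply/measurable_EFinP; apply: measurable_funM => //; exact: measurableT_comp mf0.
by under eq_integral do rewrite /= normrM (ger0_norm (f00 _)).
Qed.

(** Expand ln (a(F_0) f_0) into a sum of logarithms and use that F_0 is uniform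
    under f_0 dx. The bound on a makes both terms integrable. *)
Lemma entropy_split (f0 a : R -> R) (C : R) :
  is_density f0 -> finite_log_moment f0 -> measurable_fun setT a ->
  (forall u, 0 <= a u <= C) ->
  entropy (fun x => a (distr_fun f0 x) * f0 x) =
  (- (\int[mu]_(u in `[0, 1]) (a u * ln (a u))
      + \int[mu]_x (ln (f0 x) * (a (distr_fun f0 x) * f0 x))))%:E.
Proof.
move=> df0 lf0 ma aC; have [mf0 f00 _] := df0; have fi0 := is_density_integrable df0.
have mF : measurable_fun setT (distr_fun f0) := measurable_distr_fun f00 fi0.
have maF := measurableT_comp ma mF.
have mphi : measurable_fun setT (fun u => a u * ln (a u)).
  by apply: measurable_funM => //; exact: measurableT_comp ma.
have i1 : mu.-integrable setT
    (fun x => (a (distr_fun f0 x) * ln (a (distr_fun f0 x)) * f0 x)%:E).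
  apply: (@integrable_bounded_mul R
    (fun x => a (distr_fun f0 x) * ln (a (distr_fun f0 x))) _ (1 + C ^+ 2)) => //.
    exact: (measurableT_comp mphi mF).
  by move=> x; exact: xlnx_bound.
have i2 : mu.-integrable setT
    (fun x => (ln (f0 x) * (a (distr_fun f0 x) * f0 x))%:E).
  have aCn x : `|a (distr_fun f0 x)| <= C.
    by have /andP[? ?] := aC (distr_fun f0 x); rewrite ger0_norm.
  have := integrable_bounded_mul maF aCn (log_moment_integrable df0 lf0).
  by apply: eq_integrable => // x _; rewrite /= mulrCA.
rewrite /entropy EFinN -(Rintegral_density_distr_fun df0 mphi) -RintegralD//.
rewrite /Rintegral fineK; last first.
  apply: integrable_fin_num => //.
  by have := integrableD measurableT i1 i2; exact: eq_integrable.
congr (- _)%E; apply: eq_integral => x _; congr EFin.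
have [->|fx] := eqVneq (f0 x) 0; first by rewrite !mulr0 mul0r addr0.
have [->|ax] := eqVneq (a (distr_fun f0 x)) 0; first by rewrite !mul0r mulr0 addr0.
rewrite lnM ?posrE; first by ring.
  by rewrite lt_neqAle eq_sym ax; have /andP[] := aC (distr_fun f0 x).
by rewrite lt_neqAle eq_sym fx f00.
Qed.

End entropy.

(** * Asymptotic entropy of the flow *)
Section flow_slope_kernel.
Context {R : realType}.
Local Notation mu := (@lebesgue_measure R).

Lemma flow_slope_sym (e u : R) : flow_slope e (1 - u) = flow_slope e u.
Proof. by rewrite /flow_slope sin_pi_sym cos_pi_sym sqrrN. Qed.

Lemma flow_slope_homo (e u v : R) : 0 < e -> e <= 1 ->
  0 <= u -> u <= v -> v <= 1 / 2 -> 0 <= flow_slope e u <= flow_slope e v.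
Proof.
move=> e0 e1 u0 uv v2; rewrite ltW ?flow_slope_gt0//=.
rewrite ler_wpM2l ?(ltW e0)// lef_pV2 ?posrE ?flow_den_gt0 ?exprn_gt0//.
have := sin_pi_sqr_homo u0 uv v2; rewrite !cos2sin2.
have e2 : e ^+ 2 <= 1 by rewrite expr_le1// ltW.
move: (sin (pi * u) ^+ 2) (sin (pi * v) ^+ 2) (e ^+ 2) e2 => x y z; nra.
Qed.

Lemma flow_slope_le (e u : R) : 0 < e -> e <= 1 -> 0 <= flow_slope e u <= e^-1.
Proof.
move=> e0 e1; rewrite ltW ?flow_slope_gt0//= /flow_slope.
rewrite ler_pdivrMr ?flow_den_gt0 ?exprn_gt0// ler_pdivlMl//.
have e2 : e ^+ 2 <= 1 by rewrite expr_le1// ltW.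
have := cos2Dsin2 (pi * u); have := sqr_ge0 (cos (pi * u)).
rewrite -expr2; move: (sin (pi * u) ^+ 2) (cos (pi * u) ^+ 2) (e ^+ 2) e2 => x y z; nra.
Qed.

Lemma cvg_flow_slope0 (u : R) : 0 <= u < 1 / 2 ->
  flow_slope e u @[e --> 0^'+] --> (0 : R).
Proof.
move=> /andP[u0 u2].
have ec : e @[e --> (0 : R)^'+] --> (0 : R) by exact: cvg_at_right_filter.
have c0 : cos (pi * u) != 0 by rewrite cos_pi_eq0; lra.
rewrite [X in _ --> X](_ : _ = 0 / (cos (pi * u) ^+ 2 + 0 * 0 * sin (pi * u) ^+ 2)).
  2: by rewrite mul0r.
apply: cvgM; first exact: ec.
apply: cvgV; first by rewrite !mul0r addr0 expf_neq0.
apply: cvgD; first exact: cvg_cst.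
apply: cvgM; last exact: cvg_cst.
exact: (cvgM ec ec).
Qed.

Lemma is_density_flow_slope (f0 : R -> R) (e : R) : is_density f0 -> 0 < e ->
  is_density (fun x => flow_slope e (distr_fun f0 x) * f0 x).
Proof.
move=> df0 e0; have [mf0 f00 _] := df0.
have ms := continuous_measurable_fun (continuous_flow_slope e0).
split.
- apply: measurable_funM => //.
  exact: (measurableT_comp ms (measurable_distr_fun f00 (is_density_integrable df0))).
- by move=> x; rewrite mulr_ge0// ltW// flow_slope_gt0.
- rewrite (integral_density_distr_fun df0 ms).
  rewrite (integral_derive ler01 (is_derive_flow_map e0) (continuous_flow_slope e0)).
  by rewrite flow_map0 flow_map1 subr0.
Qed.

(** At the image v = flow_map e u the slope has no denominator: it equals
    (sin^2 (pi v) + e^2 cos^2 (pi v)) / e. *)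
Lemma ln_flow_slope (e u : R) : 0 < e ->
  ln (flow_slope e u) = - ln e + logsin e (flow_map e u).
Proof.
move=> e0; have [k k0 [sE cE]] := flow_map_angle e0 u.
have D0 := flow_den_gt0 u (exprn_gt0 2 e0).
have kD : k ^+ 2 * (cos (pi * u) ^+ 2 + e ^+ 2 * sin (pi * u) ^+ 2) = 1.
  by rewrite -(cos2Dsin2 (pi * flow_map e u)) sE cE; ring.
rewrite /logsin /flow_slope sE cE.
have -> : (k * (e * sin (pi * u))) ^+ 2 + e ^+ 2 * (k * cos (pi * u)) ^+ 2
    = e * (e * k ^+ 2).
  by have := cos2Dsin2 (pi * u); move=> cs; rewrite -[in RHS](mulr1 (k ^+ 2)) -cs; ring.
have -> : e / (cos (pi * u) ^+ 2 + e ^+ 2 * sin (pi * u) ^+ 2) = e * k ^+ 2.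
  by apply: (mulIf (lt0r_neq0 D0)); rewrite mulfVK ?gt_eqF// -mulrA kD mulr1.
by rewrite [in RHS]lnM ?posrE// ?mulr_gt0 ?exprn_gt0// addKr.
Qed.

(** Substitute v = flow_map e u, whose slope is the other factor of the
    integrand; [ln_flow_slope] then leaves the integral of [logsin_intE]. *)
Lemma Rintegral_flow_slope_ln (e : R) : 0 < e -> e <= 1 ->
  \int[mu]_(u in `[0, 1]) (flow_slope e u * ln (flow_slope e u))
  = - ln e + 2 * ln ((1 + e) / 2).
Proof.
move=> e0 e1; rewrite -(logsin_intE e0 e1).
have i01 (phi : R -> R) := @continuous_integrable01 R phi.
have cstE (a : R) : \int[mu]_(u in `[0, 1]) a = a.
  by rewrite Rintegral_cst//= lebesgue_measure_itv/= lte01 sube0 mulr1.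
pose G (v : R) := - ln e + logsin e v.
have cG : continuous G.
  by move=> v; apply: cvgD; [exact: cvg_cst|exact: continuous_logsin].
have d1 : derive1 (flow_map e) = flow_slope e.
  by apply/funext => u; have du := is_derive_flow_map e0 u; rewrite derive1E derive_val.
transitivity (\int[mu]_(u in `[0, 1]) G u); last first.
  rewrite RintegralD//=; [by rewrite cstE| |].
  - by apply: i01 => u; exact: cvg_cst.
  - exact/i01/continuous_logsin.
rewrite /Rintegral; congr fine; apply/esym.
have := @integration_by_substitution_increasing R (flow_map e) G 0 1 ler01.
rewrite d1 flow_map0 flow_map1 => -> //.
- by apply: eq_integral => u _; rewrite !fctE /G -ln_flow_slope// mulrC.
- apply: gtr0_derive1_lt_cc.
  + by move=> u _; have [] := is_derive_flow_map e0 u.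
  + by move=> u _; rewrite d1 flow_slope_gt0.
  + apply: continuous_subspaceT => u.
    by apply/differentiable_continuous/derivable1_diffP; have [] := is_derive_flow_map e0 u.
- by move=> u _; exact: continuous_flow_slope.
- apply/cvg_ex; exists (flow_slope e 0).
  by apply: cvg_at_right_filter; exact: continuous_flow_slope.
- apply/cvg_ex; exists (flow_slope e 1).
  by apply: cvg_at_left_filter; exact: continuous_flow_slope.
- by apply: derivable_LRcontinuous => u; have [] := is_derive_flow_map e0 u.
- exact: continuous_subspaceT.
Qed.

End flow_slope_kernel.

Section flow_entropy.
Context {R : realType}.
Local Notation mu := (@lebesgue_measure R).
Variables (f0 : R -> R) (m : R).
Hypotheses (dpf0 : is_density_Dplus f0) (Fm : distr_fun f0 m = 1 / 2).
Hypothesis lf0 : finite_log_moment f0.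

Let df0 : is_density f0. Proof. by case: dpf0. Qed.
Let fm0 : 0 < f0 m. Proof. exact: median_density_gt0. Qed.

Lemma ln_density_continuous : {for m, continuous (fun x => ln (f0 x))}.
Proof.
apply: continuous_comp; first exact: median_density_continuous.
exact: continuous_ln.
Qed.

(* the mean of ln f_0 under the solution at the time t with e = e^-t *)
Let cross (e : R) := \int[mu]_x (ln (f0 x) * (flow_slope e (distr_fun f0 x) * f0 x)).

Let cvg_cross : cross e @[e --> 0^'+] --> ln (f0 m).
Proof.
apply: (@concentration_median R f0 m dpf0 Fm _ (0 : R)^'+ _ flow_slope (fun x => ln (f0 x))).
- near=> e; apply: is_density_flow_slope => //; near: e; exact: nbhs_right_gt.
- near=> e; apply: continuous_measurable_fun; apply: continuous_flow_slope.
  by near: e; exact: nbhs_right_gt.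
- by move=> e u; exact: flow_slope_sym.
- near=> e => u v; apply: flow_slope_homo; first by near: e; exact: nbhs_right_gt.
  by near: e; exact: nbhs_right_le.
- by move=> u; exact: cvg_flow_slope0.
- exact: log_moment_integrable.
- exact: ln_density_continuous.
Unshelve. all: by end_near. Qed.

Variable f : R -> R -> R.
Hypothesis mildf : mild_solution f0 f.

Let mild_entropyE t : 0 <= t ->
  entropy (f t) = (- (t + 2 * ln ((1 + expR (- t)) / 2) + cross (expR (- t))))%:E.
Proof.
move=> t0; have e0 := expR_gt0 (- t).
have e1 : expR (- t) <= 1 by rewrite -expR0 ler_expR oppr_le0.
have [mft _ _] : is_density (f t) by case: mildf => _ + _ _; exact.
have [mgt _ _] := is_density_flow_slope df0 e0.
rewrite (entropy_ae mft mgt (mild_densityE df0 mildf t0)).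
rewrite (@entropy_split R f0 (flow_slope (expR (- t))) (expR (- t))^-1)//.
- by rewrite Rintegral_flow_slope_ln// expRK opprK.
- exact: continuous_measurable_fun (continuous_flow_slope e0).
- by move=> u; exact: flow_slope_le.
Qed.

Lemma cvg_mild_entropy :
  (entropy (f t) + t%:E)%E @[t --> +oo%R] --> (ln (4 / f0 m))%:E.
Proof.
have lim : (- (2 * ln ((1 + expR (- t)) / 2) + cross (expR (- t))))%:E
    @[t --> +oo%R] --> (ln (4 / f0 m))%:E.
  apply: cvg_EFin; first exact: nearW.
  have -> : ln (4 / f0 m) = - (2 * ln ((1 + 0) / 2) + ln (f0 m)).
    rewrite addr0 div1r lnV ?posrE// ln_div ?posrE//.
    have -> : 4 = 2 ^+ 2 :> R by rewrite -natrX.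
    by rewrite lnXn// mulr2n; ring.
  apply: cvgN; apply: cvgD; last exact: (cvg_comp _ _ (@cvg_expRN_right R) cvg_cross).
  apply: cvgM; first exact: cvg_cst.
  apply: continuous_cvg; first by apply: continuous_ln; rewrite addr0.
  apply: cvgM; last exact: cvg_cst.
  by apply: cvgD; [exact: cvg_cst|exact: cvgr_expR].
apply: cvg_trans lim; apply: near_eq_cvg; near=> t.
have t0 : 0 <= t by near: t; exact: nbhs_pinfty_ge.
by rewrite mild_entropyE// -EFinD; congr EFin; ring.
Unshelve. all: by end_near. Qed.

Lemma cvg_mild_entropy_rate (s : R) : 0 <= s ->
  (entropy (f (t + s)%R) - entropy (f t))%E @[t --> +oo%R] --> (- s)%:E.
Proof.
move=> s0; pose h (t : R) := fine (entropy (f t)) + t.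
have fin t : 0 <= t -> entropy (f t) \is a fin_num by move=> t0; rewrite mild_entropyE.
have cvgh : h t @[t --> +oo%R] --> ln (4 / f0 m).
  have /fine_cvgP[_] := cvg_mild_entropy; apply: cvg_trans; apply: near_eq_cvg.
  near=> t; have t0 : 0 <= t by near: t; exact: nbhs_pinfty_ge.
  by rewrite /= fineD// fin.
have cvghs : h (t + s) @[t --> +oo%R] --> ln (4 / f0 m).
  apply: (cvg_comp (fun t => t + s) h); last exact: cvgh.
  exact: cvg_addrr.
have lim : (h (t + s) - h t - s)%:E @[t --> +oo%R] --> (- s)%:E.
  apply: cvg_EFin; first exact: nearW.
  rewrite [X in _ --> X](_ : _ = ln (4 / f0 m) - ln (4 / f0 m) - s); last first.
    by rewrite subrr add0r.
  by apply: cvgB; [exact: cvgB|exact: cvg_cst].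
apply: cvg_trans lim; apply: near_eq_cvg; near=> t.
have t0 : 0 <= t by near: t; exact: nbhs_pinfty_ge.
have ts0 : 0 <= t + s by rewrite addr_ge0.
rewrite -(fineK (fin _ ts0)) -(fineK (fin _ t0)) /= -EFinB; congr EFin.
by rewrite /h; ring.
Unshelve. all: by end_near. Qed.

End flow_entropy.

(** * Entropy of the Cauchy law *)
Section cauchy_entropy.
Context {R : realType}.
Local Notation mu := (@lebesgue_measure R).

(** The Cauchy density is sin^2 (pi G) / (pi g), where G is its distribution
    function. As G is uniform, minus the entropy is the integral of
    ln (sin^2 (pi u)) - ln (pi g) over [0,1]. *)
Lemma entropy_cauchy (g : R) : 0 < g ->
  entropy (cauchy_density 0 g) = (ln (4 * pi * g))%:E.
Proof.
move=> g0; have dc := is_density_cauchy g0; have pi0 := @pi_gt0 R.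
have cE x : cauchy_density 0 g x =
    sin (pi * distr_fun (cauchy_density 0 g) x) ^+ 2 / (pi * g).
  rewrite distr_fun_cauchy// /cauchy_cdf mulrDr mul1r.
  rewrite [pi * (_ / pi)]mulrCA divff ?gt_eqF// mulr1 addrC sinDpihalf cos_atan.
  rewrite exprVn sqr_sqrtr; last by rewrite addr_ge0// sqr_ge0.
  rewrite /cauchy_density subr0.
  have : x ^+ 2 + g ^+ 2 != 0 by rewrite gt_eqF// ltr_wpDl ?sqr_ge0// exprn_gt0.
  have : 1 + (x / g) ^+ 2 != 0 by rewrite gt_eqF// ltr_pwDl// sqr_ge0.
  move: (pi : R) (lt0r_neq0 pi0) (lt0r_neq0 g0) => p pn gn Dn En.
  by field; rewrite gn pn addrC En.
have pg0 : 0 < pi * g by rewrite mulr_gt0.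
pose phi (u : R) := logsin 0 u - ln (pi * g).
have mphi : measurable_fun setT phi.
  by apply: measurable_funB => //; exact: measurable_logsin.
have icst : mu.-integrable `[0, 1] (EFin \o (fun=> ln (pi * g))).
  by apply: continuous_integrable01 => u; exact: cvg_cst.
have phiE : \int[mu]_(u in `[0, 1]) phi u = - ln (4 * pi * g).
  rewrite RintegralB//; last exact: integrable_logsin0.
  rewrite Rintegral_logsin0 Rintegral_cst//= lebesgue_measure_itv/= lte01.
  rewrite sube0 mulr1 -opprD; congr (- _).
  have -> : 4 * pi * g = 2 ^+ 2 * (pi * g) by rewrite -natrX mulrA.
  by rewrite [RHS]lnM ?posrE ?exprn_gt0// lnXn// mulr_natl.
have iphi : mu.-integrable `[0, 1] (EFin \o phi).
  rewrite (_ : _ \o _ = (EFin \o logsin 0) \- (EFin \o (fun=> ln (pi * g))))%E.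
    by apply: integrableB => //; exact: integrable_logsin0.
  by apply/funext => u; rewrite /= EFinB.
suff intE : (\int[mu]_x (cauchy_density 0 g x * ln (cauchy_density 0 g x))%:E
    = (- ln (4 * pi * g))%:E)%E by rewrite /entropy intE EFinN oppeK.
rewrite -phiE /Rintegral fineK; last by apply: integrable_fin_num => //; exact: measurable_itv.
rewrite -(integral_density_distr_fun dc mphi); apply: eq_integral => x _.
have c0 : 0 < cauchy_density 0 g x.
  by rewrite divr_gt0// mulr_gt0// ltr_wpDl ?sqr_ge0// exprn_gt0.
congr EFin; rewrite mulrC; congr (_ * _); rewrite /phi /logsin expr0n mul0r addr0.
rewrite cE ln_div ?posrE//; move: c0; rewrite cE.
by rewrite pmulr_lgt0 ?invr_gt0.
Qed.

End cauchy_entropy.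

(** * The scalar map of the discrete iteration *)
Section rho_map.
Context {R : realType}.

Definition rho_slope (u : R) : R := 2 * sin (pi * u) ^+ 2.

Definition rho_map (u : R) : R := u - sin (2 * pi * u) / (2 * pi).

(** The derivative of the n-th iterate of [rho_map]. The last factor belongs to
    the innermost map, to match the effect of applying rho to a density
    first ([iter_rhoE]). *)
Fixpoint iter_slope (n : nat) (u : R) : R :=
  if n is n'.+1 then iter_slope n' (rho_map u) * rho_slope u else 1.

Lemma is_derive_rho_map (u : R) : is_derive u (1 : R) rho_map (rho_slope u).
Proof.
have pi0 : pi != 0 :> R by rewrite gt_eqF// pi_gt0.
rewrite /rho_map; apply: is_derive_eq; rewrite cos_2pi /GRing.scale/= /rho_slope.
move: (sin (2 * pi * u)) (sin (pi * u)) => s2 s.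
by move: (pi : R) pi0 => p pn0; field.
Qed.

Lemma continuous_rho_slope : continuous rho_slope.
Proof.
move=> u; apply: cvgM; first exact: cvg_cst.
exact: (cvgM (@continuous_sin_pi R u) (@continuous_sin_pi R u)).
Qed.

Lemma continuous_rho_map : continuous rho_map.
Proof.
move=> u; apply/differentiable_continuous/derivable1_diffP.
by have [] := is_derive_rho_map u.
Qed.

Lemma rho_slope_ge0 u : 0 <= rho_slope u.
Proof. by rewrite mulr_ge0// sqr_ge0. Qed.

Lemma rho_slope_le2 u : rho_slope u <= 2.
Proof.
rewrite /rho_slope; have := cos2Dsin2 (pi * u); have := sqr_ge0 (cos (pi * u)).
by lra.
Qed.

Lemma rho_map0 : rho_map 0 = 0.
Proof. by rewrite /rho_map mulr0 sin0 mul0r subrr. Qed.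

Lemma rho_map_half : rho_map (1 / 2) = 1 / 2.
Proof.
rewrite /rho_map (_ : 2 * pi * (1 / 2) = pi); first by rewrite sinpi mul0r subr0.
by rewrite mul1r mulrAC divff ?mul1r// pnatr_eq0.
Qed.

Lemma rho_map_sym u : rho_map (1 - u) = 1 - rho_map u.
Proof.
rewrite /rho_map (sin_2pi (1 - u)) sin_pi_sym cos_pi_sym (sin_2pi u); ring.
Qed.

Lemma rho_map1 : rho_map 1 = 1.
Proof. by have := rho_map_sym 0; rewrite subr0 rho_map0 subr0. Qed.

Lemma rho_slope_sym u : rho_slope (1 - u) = rho_slope u.
Proof. by rewrite /rho_slope sin_pi_sym. Qed.

Lemma rho_map_homo : {homo rho_map : u v / u <= v}.
Proof.
move=> u v uv; rewrite -subr_ge0 -lee_fin.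
rewrite -(integral_derive uv is_derive_rho_map continuous_rho_slope).
by apply: integral_ge0 => x _; rewrite lee_fin rho_slope_ge0.
Qed.

Lemma rho_map_half_itv u : 0 <= u <= 1 / 2 -> 0 <= rho_map u <= 1 / 2.
Proof.
move=> /andP[u0 u2]; apply/andP; split.
  by rewrite -[leLHS]rho_map0 rho_map_homo.
by rewrite -[leRHS]rho_map_half rho_map_homo.
Qed.

Lemma rho_map_le u : 0 <= u <= 1 / 2 -> rho_map u <= u.
Proof.
move=> /andP[u0 u2]; have p0 := @pi_gt0 R.
rewrite /rho_map lerBlDr lerDl divr_ge0 ?mulr_ge0 ?(ltW p0)//.
by rewrite sin_ge0_pi//; apply/andP; split; nra.
Qed.

Lemma iter_rho_map_itv n u : 0 <= u <= 1 / 2 -> 0 <= iter n rho_map u <= 1 / 2.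
Proof. by move=> u2; elim: n => //= n; exact: rho_map_half_itv. Qed.

(** The iterates decrease, and the only fixed point of the map in [0, 1/2[
    is 0. *)
Lemma iter_rho_map_cvg0 (v : R) : 0 <= v < 1 / 2 ->
  iter n rho_map v @[n --> \oo] --> (0 : R).
Proof.
move=> /andP[v0 v2]; pose s n := iter n rho_map v.
have sitv n : 0 <= s n <= 1 / 2 by apply: iter_rho_map_itv; rewrite v0 ltW.
have nis : nonincreasing_seq s.
  by apply/nonincreasing_seqP => n; exact: rho_map_le.
have cs : cvgn s.
  by apply: nonincreasing_is_cvgn => //; exists 0 => _ [n _ <-]; case/andP: (sitv n).
have c1 : s n.+1 @[n --> \oo] --> limn s by rewrite (cvg_shiftS s).
have c2 : s n.+1 @[n --> \oo] --> rho_map (limn s).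
  by apply: (cvg_comp s rho_map cs); exact: continuous_rho_map.
have Tlim : rho_map (limn s) = limn s.
  by rewrite -(cvg_lim (@Rhausdorff R) c2) (cvg_lim (@Rhausdorff R) c1).
have L0 : 0 <= limn s.
  by apply: limr_ge => //; apply: nearW => n; case/andP: (sitv n).
have Lv : limn s <= v.
  by apply: limr_le => //; apply: nearW => n; exact: (nis 0%N n).
suff <- : limn s = 0 by exact: cs.
move/eqP: Tlim; rewrite /rho_map -subr_eq0 addrAC subrr add0r oppr_eq0.
have p0 := @pi_gt0 R.
rewrite mulf_eq0 invr_eq0 mulf_eq0 pnatr_eq0 (gt_eqF p0) !orbF => /eqP sL.
apply/le_anti; rewrite L0 andbT leNgt; apply/negP => Lpos.
have : 0 < sin (2 * pi * limn s).
  by apply: sin_gt0_pi; apply/andP; split; nra.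
by rewrite sL ltxx.
Qed.

Lemma iter_slope_ge0 n u : 0 <= iter_slope n u.
Proof.
by elim: n u => //= n IHn u; rewrite mulr_ge0 ?rho_slope_ge0.
Qed.

Lemma iter_slope_le n u : iter_slope n u <= 2 ^+ n.
Proof.
elim: n u => //= n IHn u; rewrite exprSr.
by apply: ler_pM; rewrite ?iter_slope_ge0 ?rho_slope_ge0 ?rho_slope_le2.
Qed.

Lemma iter_slope_sym n u : iter_slope n (1 - u) = iter_slope n u.
Proof. by elim: n u => //= n IHn u; rewrite rho_map_sym IHn rho_slope_sym. Qed.

Lemma continuous_iter_slope n : continuous (iter_slope n).
Proof.
elim: n => [|n IHn] u /=; first exact: cvg_cst.
apply: cvgM; last exact: continuous_rho_slope.
by apply: continuous_comp; [exact: continuous_rho_map|exact: IHn].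
Qed.

(** A product of nonnegative nondecreasing functions, as [rho_map] preserves
    [0, 1/2] and its order. *)
Lemma iter_slope_homo n u v : 0 <= u -> u <= v -> v <= 1 / 2 ->
  0 <= iter_slope n u <= iter_slope n v.
Proof.
move=> u0 uv v2; rewrite iter_slope_ge0/=.
elim: n u v u0 uv v2 => //= n IHn u v u0 uv v2.
apply: ler_pM; rewrite ?iter_slope_ge0 ?rho_slope_ge0//.
  have /andP[Tu _] : 0 <= rho_map u <= 1 / 2 by apply: rho_map_half_itv; rewrite u0 (le_trans uv).
  have /andP[_ Tv] : 0 <= rho_map v <= 1 / 2 by apply: rho_map_half_itv; rewrite v2 (le_trans u0).
  by apply: IHn => //; exact: rho_map_homo.
by rewrite ler_wpM2l// sin_pi_sqr_homo.
Qed.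

Lemma is_derive_iter_rho_map n (u : R) :
  is_derive u (1 : R) (iter n rho_map) (iter_slope n u).
Proof.
elim: n u => [|n IHn] u; first exact: is_derive_id.
rewrite (_ : iter n.+1 rho_map = iter n rho_map \o rho_map); last first.
  by apply/funext => v; rewrite iterSr.
exact: (@is_derive1_comp R (iter n rho_map) rho_map u _ _ (IHn _) (is_derive_rho_map u)).
Qed.

(** The slope is nondecreasing on [0, 1/2]. So its value at u is at most the
    difference quotient of the n-th iterate between u and some v < 1/2, and that
    quotient tends to 0 by [iter_rho_map_cvg0]. *)
Lemma iter_slope_cvg0 (u : R) : 0 <= u < 1 / 2 ->
  iter_slope n u @[n --> \oo] --> (0 : R).
Proof.
move=> /andP[u0 u2]; pose v := (u + 1 / 2) / 2.
have uv : u < v by rewrite /v; lra.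
have v2 : v < 1 / 2 by rewrite /v; lra.
have vu : 0 < v - u by rewrite subr_gt0.
have bound n : 0 <= iter_slope n u <= iter n rho_map v / (v - u).
  rewrite iter_slope_ge0 ler_pdivlMr//=.
  have [||c cuv eqc] := @MVT R (iter n rho_map) (iter_slope n) u v uv.
  - by move=> x _; exact: is_derive_iter_rho_map.
  - apply: continuous_subspaceT => x; apply/differentiable_continuous/derivable1_diffP.
    by have [] := is_derive_iter_rho_map n x.
  have /andP[Tu _] : 0 <= iter n rho_map u <= 1 / 2 by apply: iter_rho_map_itv; lra.
  apply: (@le_trans _ _ (iter n rho_map v - iter n rho_map u)); last by lra.
  rewrite eqc ler_wpM2r ?(ltW vu)//; move: cuv; rewrite in_itv/= => /andP[uc cv].
  have c2 : c <= 1 / 2 by rewrite ltW// (lt_trans cv).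
  by have /andP[] := iter_slope_homo n u0 (ltW uc) c2.
apply: (@squeeze_cvgr _ _ _ _ (fun=> 0) (fun n => iter n rho_map v / (v - u))).
- by near=> n; exact: bound.
- exact: cvg_cst.
rewrite [X in _ --> X](_ : 0 = 0 / (v - u)); last by rewrite mul0r.
apply: cvgM; last exact: cvg_cst.
by apply: iter_rho_map_cvg0; rewrite v2 (le_trans u0 (ltW uv)).
Unshelve. all: by end_near. Qed.

End rho_map.

(** * Densities under the iteration *)
Section rho_density.
Context {R : realType}.

Lemma rhoE (f : R -> R) : rho f = (fun x => rho_slope (distr_fun f x) * f x).
Proof. by []. Qed.

Lemma is_density_rho (f : R -> R) : is_density f -> is_density (rho f).
Proof.
move=> df; have [mf f0 _] := df; rewrite rhoE.
have ms := continuous_measurable_fun (@continuous_rho_slope R).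
split.
- apply: measurable_funM => //.
  exact: (measurableT_comp ms (measurable_distr_fun f0 (is_density_integrable df))).
- by move=> x; rewrite mulr_ge0// rho_slope_ge0.
- rewrite (integral_density_distr_fun df ms).
  rewrite (integral_derive ler01 (@is_derive_rho_map R) (@continuous_rho_slope R)).
  by rewrite rho_map0 rho_map1 subr0.
Qed.

Lemma distr_fun_rho (f : R -> R) (x : R) : is_density f ->
  distr_fun (rho f) x = rho_map (distr_fun f x).
Proof.
move=> df; have [_ f0 _] := df.
rewrite rhoE [LHS](Rintegral_distr_fun_chain f0 (is_density_integrable df) x
  (@is_derive_rho_map R) (@continuous_rho_slope R)).
by rewrite rho_map0 subr0.
Qed.

Lemma iter_rhoE n (f : R -> R) : is_density f ->
  is_density (iter n (@rho R) f) /\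
  iter n (@rho R) f = (fun x => iter_slope n (distr_fun f x) * f x).
Proof.
elim: n f => [|n IHn] f df /=.
  by split => //; apply/funext => x; rewrite mul1r.
have [dfn fnE] := IHn _ (is_density_rho df).
rewrite -iterS iterSr; split => //; rewrite fnE; apply/funext => x.
by rewrite distr_fun_rho// rhoE mulrA.
Qed.

End rho_density.

(** * Asymptotic entropy of the iteration *)
Section iterated_entropy.
Context {R : realType}.
Local Notation mu := (@lebesgue_measure R).
Variable f0 : R -> R.
Hypotheses (dpf0 : is_density_Dplus f0) (lf0 : finite_log_moment f0).

Let df0 : is_density f0. Proof. by case: dpf0. Qed.
Let fi0 := is_density_integrable df0.
Let f00 x : 0 <= f0 x. Proof. by case: df0. Qed.
Let F := distr_fun f0.
Let mF : measurable_fun setT F := measurable_distr_fun f00 fi0.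

Let S n := \int[mu]_(u in `[0, 1]) (iter_slope n u * ln (iter_slope n u)).
Let K n := \int[mu]_x (ln (f0 x) * (iter_slope n (F x) * f0 x)).
(* the logarithm of [rho_slope] where this slope is positive *)
Let psi (u : R) := ln 2 + logsin 0 u.
Let L n := \int[mu]_x (psi (F x) * (iter_slope n (F x) * f0 x)).

Let ma n : measurable_fun setT (@iter_slope R n).
Proof. exact: continuous_measurable_fun (@continuous_iter_slope R n). Qed.

Let mpsi : measurable_fun setT psi.
Proof. by apply: measurable_funD => //; exact: measurable_logsin. Qed.

Let entropy_iterE n : entropy (iter n (@rho R) f0) = (- (S n + K n))%:E.
Proof.
have [_ ->] := iter_rhoE n df0.
apply: (entropy_split (C := 2 ^+ n)) => // u.
by rewrite iter_slope_ge0 iter_slope_le.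
Qed.

Let ipsi : mu.-integrable setT (fun x => (psi (F x) * f0 x)%:E).
Proof.
apply: (integrable_density_distr_fun df0 mpsi).
rewrite (_ : _ \o _ = (EFin \o (fun=> ln 2)) \+ (EFin \o logsin 0))%E; last first.
  by apply/funext => u; rewrite /= EFinD.
apply: integrableD => //; last exact: integrable_logsin0.
by apply: continuous_integrable01 => u; exact: cvg_cst.
Qed.

(* the slope of the iterate is a product, and f_1 dx is uniform in the scale of F_1 *)
Let S_step n : S n.+1 = S n + L n.+1.
Proof.
have aln_bound k (u : R) : `|iter_slope k u * ln (iter_slope k u)| <= 1 + (2 ^+ k) ^+ 2.
  by apply: xlnx_bound; rewrite iter_slope_ge0 iter_slope_le.
have mln k : measurable_fun setT (fun u : R => iter_slope k u * ln (iter_slope k u)).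
  by apply: measurable_funM => //; exact: measurableT_comp (ma k).
have d1 := is_density_rho df0; have [_ f10 _] := d1.
rewrite /S -(Rintegral_density_distr_fun df0 (mln n.+1)).
rewrite -(Rintegral_density_distr_fun d1 (mln n)) -RintegralD//.
- apply: eq_Rintegral => x _; rewrite distr_fun_rho// rhoE -/(F x) /=.
  set a := iter_slope n (rho_map (F x)); set b := rho_slope (F x).
  have [b0|bn0] := eqVneq b 0; first by rewrite b0 !(mulr0, mul0r) addr0.
  have [->|an0] := eqVneq a 0; first by rewrite !(mulr0, mul0r) addr0.
  have apos : 0 < a by rewrite lt_neqAle eq_sym an0 iter_slope_ge0.
  have bpos : 0 < b by rewrite lt_neqAle eq_sym bn0 rho_slope_ge0.
  have -> : psi (F x) = ln b.
    have spos : 0 < sin (pi * F x) ^+ 2 by move: bpos; rewrite /b /rho_slope pmulr_rgt0.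
    by rewrite /psi /logsin expr0n mul0r addr0 /b /rho_slope lnM ?posrE.
  by rewrite lnM ?posrE//; ring.
- apply: (@integrable_bounded_mul R _ _ _ _ (fun x => aln_bound n (distr_fun (rho f0) x))).
    apply: (measurableT_comp (mln n)).
    exact: measurable_distr_fun f10 (is_density_integrable d1).
  exact: is_density_integrable d1.
- have aC x : `|iter_slope n.+1 (F x)| <= 2 ^+ n.+1.
    by rewrite ger0_norm ?iter_slope_ge0// iter_slope_le.
  have := integrable_bounded_mul (measurableT_comp (ma n.+1) mF) aC ipsi.
  by apply: eq_integrable => // x _; rewrite /= [in RHS]mulrCA.
Qed.

(** By [S_step] the one-step change of the entropy is - L - K at n + 1 plus K at
    n. The means K and L concentrate at the median, K tending to ln f_0(m) and
    L to ln 2. *)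
Lemma cvg_iter_entropy_step :
  (entropy (iter n.+1 (@rho R) f0) - entropy (iter n (@rho R) f0))%E
    @[n --> \oo] --> (- ln 2)%:E.
Proof.
have [m Fm] : exists m, F m = 1 / 2.
  apply: (distr_fun_surj f00 fi0); rewrite (is_density_mass df0); lra.
have conc (phi : R -> R) :
    mu.-integrable setT (fun x => (phi x * f0 x)%:E) -> {for m, continuous phi} ->
    \int[mu]_x (phi x * (iter_slope n (F x) * f0 x)) @[n --> \oo] --> phi m.
  move=> iphi cphi.
  apply: (@concentration_median R f0 m dpf0 Fm _ _ _ (@iter_slope R) phi) => //.
  - by apply: nearW => n; have [dn <-] := iter_rhoE n df0.
  - by apply: nearW => n; exact: ma.
  - by move=> n u; exact: iter_slope_sym.
  - by apply: nearW => n u v; exact: iter_slope_homo.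
  - by move=> u; exact: iter_slope_cvg0.
have cvgK : K n @[n --> \oo] --> ln (f0 m).
  apply: (conc (fun x => ln (f0 x))).
  - exact: log_moment_integrable.
  - exact: ln_density_continuous.
have cvgL : L n @[n --> \oo] --> ln 2.
  have -> : ln 2 = psi (F m) :> R.
    rewrite Fm /psi /logsin mul1r sin_pihalf expr1n expr0n mul0r addr0 ln1.
    by rewrite addr0.
  apply: (conc (psi \o F)) => //.
  apply: continuous_comp; first exact: continuous_distr_fun.
  rewrite Fm; apply: cvgD; first exact: cvg_cst.
  apply: continuous_comp; last first.
    by apply: continuous_ln; rewrite mul1r sin_pihalf expr1n expr0n mul0r addr0.
  apply: cvgD.
    exact: (cvgM (@continuous_sin_pi R _) (@continuous_sin_pi R _)).
  apply: cvgM; first exact: cvg_cst.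
  exact: (cvgM (@continuous_cos_pi R _) (@continuous_cos_pi R _)).
have lim : - L n.+1 - K n.+1 + K n @[n --> \oo] --> - ln 2.
  rewrite [X in _ --> X](_ : - ln 2 = - ln 2 - ln (f0 m) + ln (f0 m)); last by rewrite subrK.
  apply: cvgD; last exact: cvgK.
  apply: cvgB; last by rewrite (cvg_shiftS K).
  by apply: cvgN; rewrite (cvg_shiftS L).
have -> : (fun n => (entropy (iter n.+1 (@rho R) f0) - entropy (iter n (@rho R) f0))%E) =
    (fun n => (- L n.+1 - K n.+1 + K n)%:E).
  by apply/funext => n; rewrite !entropy_iterE -EFinB S_step; congr EFin; ring.
by apply: cvg_EFin; [exact: nearW|exact: lim].
Qed.

End iterated_entropy.

Unset Implicit Arguments.

Theorem theorem10 (R : realType) :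
  (forall (f0 : R -> R) (f : R -> R -> R),
     is_density f0 -> mild_solution f0 f ->
     [/\ (forall x t : R, 0 <= t -> distr_fun (f t) x != 1 / 2 ->
            has_deriv_at (fun s => tan (pi * distr_fun (f s) x)) t
              (- tan (pi * distr_fun (f t) x))),
         (forall x t : R, 0 <= t ->
            etan (pi * distr_fun (f t) x) =
              ((expR (- t))%:E * etan (pi * distr_fun f0 x))%E)
       & (forall t : R, 0 <= t ->
            {ae @lebesgue_measure R, forall x,
               f t x = expR (- t) * f0 x /
                 (cos (pi * distr_fun f0 x) ^+ 2
                  + expR (- (2 * t)) * sin (pi * distr_fun f0 x) ^+ 2)})])
  /\
  (forall (f0 : R -> R) (f : R -> R -> R) (m : R),
     is_density_Dplus f0 -> distr_fun f0 m = 1 / 2 -> mild_solution f0 f ->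
     (forall (d : R -> measure_display) (T : forall t, measurableType (d t))
        (P : forall t, probability (T t) R) (X : forall t, {RV (P t) >-> R}),
        (forall t, 0 <= t -> has_density (X t) (f t)) ->
        cvg_in_distribution P (fun t w => expR t * (X t w - m))
          (distr_fun (cauchy_density 0 (1 / (pi * f0 m)))))
     /\
     (finite_log_moment f0 ->
        (entropy (f t) + t%:E)%E @[t --> +oo%R] --> (ln (4 / f0 m))%:E
        /\
        (forall s : R, 0 <= s ->
           (entropy (f (t + s)%R) - entropy (f t))%E @[t --> +oo%R]
             --> (- s)%:E)))
  /\
  (forall f0 : R -> R,
     is_density_Dplus f0 -> finite_log_moment f0 ->
     (entropy (iter n.+1 (@rho R) f0) - entropy (iter n (@rho R) f0))%E
       @[n --> \oo] --> (- ln 2)%:E)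
  /\
  (forall (f0 : R -> R) (m : R),
     is_density_Dplus f0 -> distr_fun f0 m = 1 / 2 ->
     entropy (cauchy_density 0 (1 / (pi * f0 m))) = (ln (4 / f0 m))%:E).
Proof.
split; last split; last split.
- move=> f0 f df0 mildf; split.
  + by move=> x t t0 _; exact: (mild_has_deriv_tan df0 mildf).
  + move=> x t t0; rewrite (mild_distr_funE df0 mildf)//.
    by rewrite etan_flow_map// expR_gt0.
  + move=> t t0; apply: (@filterS _ _ (ae_filter_ringOfSetsType _) _ _ _
      (mild_densityE df0 mildf t0)) => x ->.
    by rewrite /flow_slope -[- (2 * t)]mulrN expRM_natl mulrAC.
- move=> f0 f m dpf0 Fm mildf; split; first exact: mild_cvg_in_distribution.
  move=> lf0; split; first exact: (cvg_mild_entropy dpf0 Fm lf0 mildf).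
  by move=> s; exact: (cvg_mild_entropy_rate dpf0 Fm lf0 mildf).
- by move=> f0 dpf0 lf0; exact: cvg_iter_entropy_step.
- move=> f0 m dpf0 Fm; have fm0 := median_density_gt0 dpf0 Fm.
  rewrite entropy_cauchy; last by rewrite divr_gt0// mulr_gt0// pi_gt0.
  congr (ln _)%:E; have := lt0r_neq0 (@pi_gt0 R).
  by move: (pi : R) (f0 m) (lt0r_neq0 fm0) => p y yn pn; field; rewrite yn pn.
Qed.
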